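(* Let $\mathscr B$ be a doubling ball-basis in a measure space $(X,\mathfrak M,\mu)$, let $1\le r<\infty$, and let $\omega(t)=1/\log_2(1+t)$ for $t\ge 1$. Let $\{T_\alpha\}$ be a family of linear operators $T_\alpha:L^r(X)\to L^0(X)$ with $T_\alpha\in \mathrm{BO}_\omega(X)$, and suppose that the family is uniformly vanishing. Let $T$ be one of the operators $$T^+(f)=\sup_\alpha T_\alpha(f),\qquad T^-(f)=\inf_\alpha T_\alpha(f),\qquad T^*(f)=\sup_\alpha|T_\alpha(f)|,$$ and suppose that $$\|T\|_{L^r(X)\to L^{r,\infty}(X)}<\infty,\qquad \sup_\alpha \mathcal L_\omega(T_\alpha)<\infty .$$ Then there is a constant $C>0$ depending only on the ball-basis $\mathscr B$ and on $r$ such that for every $f\in L^r(X)$, every ball $B\in\mathscr B$ and every $0<\beta<1$, $$\mathrm{OSC}_{B,\beta}(T(f))\le C\left((1-\beta)^{-1/r}\|T\|_{L^r(X)\to L^{r,\infty}(X)}+\sup_\alpha\mathcal L_\omega(T_\alpha)\right)\langle f\rangle^*_{\#,B}.$$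
   Context: **Ball-basis.** Let $(X,\mathfrak M,\mu)$ be a measure space. A family $\mathscr B\subset\mathfrak M$ (its members are called balls) is a ball-basis if: (B1) $0<\mu(B)<\infty$ for every $B\in\mathscr B$; (B2) for any $x,y\in X$ there is a ball containing both $x$ and $y$; (B3) for every $E\in\mathfrak M$ and $\varepsilon>0$ there is a finite or infinite sequence of balls $B_k$ with $\mu(E\triangle\bigcup_kB_k)<\varepsilon$; (B4) for every $B\in\mathscr B$ there is a ball $B^*\in\mathscr B$ (the hull-ball of $B$, fixed once and for all) such that $\bigcup\{A\in\mathscr B:\mu(A)\le2\mu(B),\ A\cap B\ne\varnothing\}\subset B^*$ and $\mu(B^* )\le\mathcal K\mu(B)$, with a constant $\mathcal K>0$ independent of $B$. The ball-basis is doubling if there is $\eta>2$ such that for every ball $B$ with $B^*\ne X$ there is a ball $B'\supset B$ with $2\mu(B)\le\mu(B')\le\eta\mu(B)$. **Notation.** $L^0(X)$ is the space of a.e. finite measurable functions. $f_B=\frac1{\mu(B)}\int_Bf$, $\langle f\rangle_B=\big(\frac1{\mu(B)}\int_B|f|^r\big)^{1/r}$, $\langle f\rangle_{\#,B}=\langle f-f_B\rangle_B$, $\langle f\rangle^*_{\#,B}=\sup_{A\in\mathscr B:A\supset B}\langle f\rangle_{\#,A}$. For a measurable set $E$ and a (possibly non-measurable) function $F$, $\mathrm{OSC}_E(F)=\operatorname{ess\,sup}_{x,x'\in E}|F(x)-F(x')|$ (the infimum over null sets $N$ of $\sup_{x,x'\in E\setminus N}|F(x)-F(x')|$), and $\mathrm{OSC}_{B,\beta}(F)=\inf\{\mathrm{OSC}_E(F):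 E\subset B \text{ measurable},\ \mu(E)>\beta\mu(B)\}$ for $0<\beta<1$. Outer measure: $\mu^*(E)=\inf_{F\in\mathfrak M,F\supset E}\mu(F)$. For an arbitrary function $F$, $\|F\|_{L^{r,\infty}}=\sup_{t>0}t\,(\mu^*\{|F|>t\})^{1/r}$, and $\|T\|_{L^r\to L^{r,\infty}}$ is the supremum of $\|T(f)\|_{L^{r,\infty}}/\|f\|_{L^r}$ over nonzero $f\in L^r(X)$. ($T(f)$ may be non-measurable.) **Operators.** For non-increasing $\omega:[1,\infty)\to[0,1]$, an operator $T:L^r(X)\to L^0(X)$ belongs to $\mathrm{BO}_\omega(X)$ if it is sublinear, $|T(f+g)|\le|T(f)|+|T(g)|$, and there is a finite constant $L$ with $$\mathrm{OSC}_B\big(T(f\cdot\mathbf 1_{X\setminus B^*})\big)\le L\sup_{A\in\mathscr B:A\supset B}\Big(\omega\Big(\frac{\mu(A)}{\mu(B)}\Big)\langle f\rangle_A\Big)$$ for all $f\in L^r(X)$ and all balls $B$; $\mathcal L_\omega(T)$ denotes the least such $L$. A family of operators $T_\alpha:L^r(X)\to L^0(X)$ is uniformly vanishing if for every ball $B$ and $\varepsilon>0$ there is a ball $B'\supset B$, independent of $\alpha$, such that $\mathrm{OSC}_B(T_\alpha(\mathbf 1_{B''}))\le\varepsilon$ for every ball $B''\supset B'$ and every $\alpha$.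
   Formalization: Added for uncountable families: the null sets in the a.e. linearity of T_α and in the ess sup defining OSC_B(T_α f) can be chosen independently of α (automatic for countable families). Without it the claim fails, e.g. T_α f = f(α−n)·1_{α} on R. *)

(* Defs.v *)
From HB Require Import structures.
From mathcomp Require Import all_boot all_order all_algebra.
From mathcomp Require Import all_classical all_reals all_analysis.
From mathcomp Require Import measurable_realfun.

Set Implicit Arguments.
Unset Strict Implicit.
Unset Printing Implicit Defensive.

Import Order.TTheory GRing.Theory Num.Theory.
Import numFieldNormedType.Exports.

Local Open Scope classical_set_scope.
Local Open Scope ring_scope.
Local Open Scope ereal_scope.

(* [hull B] is the hull-ball B^*; its values outside of [balls] are irrelevant.
   A finite or infinite sequence of balls is a countable set of balls. *)
Record ball_basis d (X : measurableType d) (R : realType)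
    (mu : {measure set X -> \bar R})
    (balls : set (set X)) (hull : set X -> set X) : Prop := BallBasis {
  ball_measurable : forall B, balls B -> measurable B;
  ball_pos : forall B, balls B -> 0 < mu B;
  ball_fin : forall B, balls B -> mu B < +oo;
  ball_pair : forall x y, exists B, [/\ balls B, B x & B y];
  ball_approx : forall (E : set X) (e : R), measurable E -> (0 < e)%R ->
    exists S : set (set X), [/\ countable S, S `<=` balls &
      mu (E `+` \bigcup_(B in S) B) < e%:E];
  hull_ball : forall B, balls B -> balls (hull B);
  hull_sub : forall B, balls B ->
    \bigcup_(A in [set A | [/\ balls A, mu A <= 2%:E * mu B
                             & A `&` B !=set0]]) A `<=` hull B;
  hull_meas : exists K : R, (0 < K)%R /\
    forall B, balls B -> mu (hull B) <= K%:E * mu B }.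

Definition doubling d (X : measurableType d) (R : realType)
    (mu : {measure set X -> \bar R})
    (balls : set (set X)) (hull : set X -> set X) : Prop :=
  exists eta : R, (2 < eta)%R /\
    forall B, balls B -> hull B <> [set: X] ->
      exists B', [/\ balls B', B `<=` B',
                     2%:E * mu B <= mu B' & mu B' <= eta%:E * mu B].

Section averages.
Context d (X : measurableType d) (R : realType).
Variables (mu : {measure set X -> \bar R}) (r : R).
Implicit Types (f : X -> R) (B : set X) (balls : set (set X)).

Definition avg B f : R := ((\int[mu]_(x in B) f x) / fine (mu B))%R.

Definition avg_r B f : \bar R :=
  ((\int[mu]_(x in B) (`|f x| `^ r)%:E) / mu B) `^ r^-1.

Definition avg_sharp B f : \bar R := avg_r B (fun x => f x - avg B f)%R.

Definition avg_sharp_star balls B f : \bar R :=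
  ereal_sup [set avg_sharp A f | A in [set A | balls A /\ B `<=` A]].

End averages.

Section oscillation.
Context d (X : measurableType d) (R : realType).
Variable mu : {measure set X -> \bar R}.
Implicit Types (E B : set X) (F : X -> \bar R).

(* When F x and F x' are the same infinity, `|F x - F x'| evaluates to +oo. *)
Definition osc_on E F : \bar R :=
  ereal_sup [set y | exists x x', [/\ E x, E x' & y = `|F x - F x'|]].

Definition OSC E F : \bar R :=
  ereal_inf [set osc_on (E `\` N) F | N in mu.-negligible].

Definition OSC_beta B (beta : R) F : \bar R :=
  ereal_inf [set OSC E F | E in
    [set E | [/\ measurable E, E `<=` B & beta%:E * mu B < mu E]]].

Definition outer (E : set X) : \bar R :=
  ereal_inf [set mu F | F in [set F | measurable F /\ E `<=` F]].

Definition weak_norm (r : R) F : \bar R :=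
  ereal_sup [set t%:E * (outer [set x | t%:E < `|F x|]) `^ r^-1
            | t in [set t : R | (0 < t)%R]].

End oscillation.

Section operators.
Context d (X : measurableType d) (R : realType).
Variables (mu : {measure set X -> \bar R}) (r : R).
Variables (balls : set (set X)) (hull : set X -> set X).
(* Elements of L^r and L^0 are represented by functions; an operator is total
   on functions, and only its values on [Lfun mu r%:E] are ever constrained. *)
Notation operator := ((X -> R) -> (X -> \bar R)).
Notation Lr := (Lfun mu r%:E).
Implicit Types (T : operator) (f g : X -> R).

Definition opnorm T : \bar R :=
  ereal_sup [set weak_norm mu r (T f) / 'N[mu]_(r%:E)[EFin \o f]
            | f in [set f | f \in Lr /\ 'N[mu]_(r%:E)[EFin \o f] != 0]].

Definition Lr_to_L0 T : Prop :=
  (forall f, f \in Lr ->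
     measurable_fun [set: X] (T f) /\ {ae mu, forall x, T f x \is a fin_num}) /\
  (forall f g, f \in Lr -> g \in Lr ->
     {ae mu, forall x, f x = g x} -> {ae mu, forall x, T f x = T g x}).

Definition linear_op T : Prop :=
  forall (a : R) f g, f \in Lr -> g \in Lr ->
    {ae mu, forall x, T (fun y => a * f y + g y)%R x = a%:E * T f x + T g x}.

Definition sublinear_op T : Prop :=
  forall f g, f \in Lr -> g \in Lr ->
    {ae mu, forall x, `|T (f \+ g)%R x| <= `|T f x| + `|T g x|}.

Definition BO_bound (omega : R -> R) T (L : R) : Prop :=
  forall f B, f \in Lr -> balls B ->
    OSC mu B (T (f \* \1_(~` hull B))%R) <=
    L%:E * ereal_sup
      [set (omega (fine (mu A) / fine (mu B)))%:E * avg_r mu r A f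
      | A in [set A | balls A /\ B `<=` A]].

Definition BO (omega : R -> R) T : Prop :=
  [/\ Lr_to_L0 T, sublinear_op T & exists L : R, BO_bound omega T L].

Definition BO_const (omega : R -> R) T : \bar R :=
  ereal_inf [set L%:E | L in [set L : R | (0 <= L)%R /\ BO_bound omega T L]].

Definition uniformly_vanishing (I : Type) (T : I -> operator) : Prop :=
  forall B (e : R), balls B -> (0 < e)%R ->
    exists B', [/\ balls B', B `<=` B' &
      forall B'' i, balls B'' -> B' `<=` B'' ->
        OSC mu B (T i \1_B'') <= e%:E].

Definition sup_op (I : Type) (T : I -> operator) : operator :=
  fun f x => ereal_sup [set T i f x | i in [set: I]].

Definition inf_op (I : Type) (T : I -> operator) : operator :=
  fun f x => ereal_inf [set T i f x | i in [set: I]].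

Definition maximal_op (I : Type) (T : I -> operator) : operator :=
  fun f x => ereal_sup [set `|T i f x| | i in [set: I]].

(* The pointwise supremum of an uncountable family of elements of L^0 depends
   on the chosen representatives (each T i f may be altered on its own null
   set, and the union of these sets can be everything).  The representatives
   are coherent when the null sets implicit in "a.e." (linearity) and in
   "ess sup" (the infimum over null sets in OSC) can be taken independent of
   i.  By [countable_coherent] this is automatic for countable families. *)
Definition coherent (I : Type) (T : I -> operator) : Prop :=
  (forall (a : R) f g, f \in Lr -> g \in Lr ->
    {ae mu, forall x, forall i,
      T i (fun y => a * f y + g y)%R x = a%:E * T i f x + T i g x}) /\
  (forall f B, f \in Lr -> balls B ->
    exists2 N, mu.-negligible N &
      forall i, osc_on (B `\` N) (T i f) <= OSC mu B (T i f)).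

End operators.

Definition omega_log (R : realType) (t : R) : R := (ln (1 + t) / ln 2)^-1%R.

Section coherence.
Context d (X : measurableType d) (R : realType).
Variable mu : {measure set X -> \bar R}.

Lemma countable_negligible (I : Type) (N : I -> set X) :
  countable [set: I] -> (forall i, mu.-negligible (N i)) ->
  mu.-negligible (\bigcup_i N i).
Proof.
move=> /countable_injP[h hinj] negN.
suff: mu.-negligible (\bigcup_n \bigcup_(i in [set i | h i = n]) N i).
  apply: negligibleS.
  by move=> x [i _ Nix]; exists (h i) => //; exists i.
apply: negligible_bigcup => n.
have [[i hi]|noi] := pselect (exists i, h i = n); last first.
  rewrite (_ : bigcup _ _ = set0); first exact: negligible_set0.
  by rewrite -subset0 => x [i /= hi _]; apply: noi; exists i.
apply: negligibleS (negN i) => x [j /= hj Njx].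
by rewrite (hinj i j) ?inE// hi hj.
Qed.

Lemma le_osc_on (E E' : set X) (F : X -> \bar R) :
  E `<=` E' -> osc_on E F <= osc_on E' F.
Proof.
move=> EE'; apply: ereal_sup_le => y [x [x' [Ex Ex' ->]]].
by exists x, x'; split => //; exact: EE'.
Qed.

Lemma OSC_attained (E : set X) (F : X -> \bar R) :
  exists2 N, mu.-negligible N & osc_on (E `\` N) F <= OSC mu E F.
Proof.
have S0 : [set osc_on (E `\` N) F | N in mu.-negligible] != set0.
  apply/set0P; exists (osc_on (E `\` set0) F), set0 => //.
  exact: negligible_set0.
have [u uS ucvg] := ereal_inf_seq S0.
have /choice[N HN] n : exists N,
    mu.-negligible N /\ osc_on (E `\` N) F = u n.
  by have [N ? ?] := uS n; exists N.
exists (\bigcup_n N n); first by apply: negligible_bigcup => n; case: (HN n).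
apply: (cvge_to_ge ucvg); apply: nearW => n.
have [_ <-] := HN n; apply: le_osc_on; apply: setDS.
by move=> x Nx; exists n.
Qed.

Lemma countable_coherent (r : R) (balls : set (set X)) (I : Type)
    (T : I -> (X -> R) -> (X -> \bar R)) :
  countable [set: I] -> (forall i, linear_op mu r (T i)) ->
  coherent mu r balls T.
Proof.
move=> cI linT; split=> [a f g Lf Lg|f B _ _].
  apply: negligibleS (countable_negligible cI (fun i => linT i a f g Lf Lg)).
  move=> x /= /existsNP[i Hi]; by exists i.
pose N i := sval (cid2 (OSC_attained B (T i f))).
have negN i : mu.-negligible (N i) by rewrite /N; case: cid2.
exists (\bigcup_i N i); first exact: countable_negligible.
move=> i; apply: (@le_trans _ _ (osc_on (B `\` N i) (T i f))).
  by apply: le_osc_on; apply: setDS => x Nx; exists i.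
by rewrite /N; case: cid2.
Qed.

End coherence.

(* Main.v *)
Require Import Defs.
From HB Require Import structures.
From mathcomp Require Import all_boot all_order all_algebra.
From mathcomp Require Import all_classical all_reals all_analysis.
From mathcomp Require Import measurable_realfun.
From mathcomp Require Import ring lra.

Set Implicit Arguments.
Unset Strict Implicit.
Unset Printing Implicit Defensive.

Import Order.TTheory GRing.Theory Num.Theory.
Import numFieldNormedType.Exports.

Local Open Scope classical_set_scope.
Local Open Scope ring_scope.
Local Open Scope ereal_scope.

(** Write [H] for [hull B], [c] for the mean [f_B], and [M] for the number
    [avg_sharp_star mu r balls B f].  Split [f = near + far], where [near] is
    [(f - c) 1_H].  The two parts are controlled for different reasons.

    The far part oscillates little under each operator of the family, and this
    needs no exceptional set beyond null sets ([OSC_far_part]).  For a large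
    ball [G], [far = c 1_G + (f - c) 1_(G \ H) + f 1_(X \ G)].  The first term is
    handled by the uniform vanishing of the family, and the last one has small
    norm, because some increasing sequence of balls covers almost all of [X].
    For the middle term, the BO condition leaves the supremum over the balls
    [A] containing [B] of [omega(mu A / mu B)] times the r-mean of [f - c] over
    [A].  A chain of doubling balls leads from [B] to a ball comparable to [A]
    in [O(1 + log_2(mu A / mu B))] steps, each of which moves the mean of [f]
    by [O(M)] ([avg_chain]).  So that r-mean grows logarithmically, and the
    weight [omega(t) = 1 / log_2(1 + t)] is just small enough to compensate
    ([log_growth]).

    The near part is controlled by the weak type of the extremal operator [T]:
    [T near] and [T (- near)] are at most [t] in absolute value outside a set of
    measure less than a fixed fraction of [(1 - beta) mu B], where [t] is of
    the order of [(1 - beta)^(-1/r)] times the operator norm times [M].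
    Whichever of [sup], [inf] or [sup |.|] defines [T], these two bounds imply
    that every operator of the family maps [near] into [-t, t] there
    ([extremal_op_bounds]).  By linearity, all the functions [Ta i f] then
    oscillate by at most the far bound plus [2t], uniformly in [i], and the
    bound passes to [T f] wherever [T f] is finite ([extremal_op_osc]). *)

(** * Norms and r-means over a set *)

Section Lp_norms.
Context d (X : measurableType d) (R : realType).
Variables (mu : {measure set X -> \bar R}) (r : R).
Hypothesis hr : (1 <= r)%R.
Notation Lr := (Lfun mu r%:E).
Notation norm f := ('N[mu]_(r%:E)[EFin \o f]).
Implicit Types (f g : X -> R) (A : set X).

Lemma Lfun_normP f : f \in Lr <-> measurable_fun [set: X] f /\ norm f < +oo.
Proof.
split; first by move=> /andP[/[!inE]].
by move=> [mf nf]; apply/andP; rewrite !inE.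
Qed.

Lemma exponent_gt0 : (0 < r)%R. Proof. exact: lt_le_trans hr. Qed.

Lemma measurable_powr_abs f : measurable_fun [set: X] f ->
  measurable_fun [set: X] (fun x => (`|f x| `^ r)%:E).
Proof.
move=> mf; apply: measurableT_comp => //.
apply: (measurableT_comp (measurable_powR _)) => //.
exact: measurableT_comp.
Qed.

Lemma Lnorm_powRE f : norm f = (\int[mu]_x (`|f x| `^ r)%:E) `^ r^-1.
Proof.
by rewrite unlock.
Qed.

Lemma le_Lnorm f g : measurable_fun [set: X] f -> measurable_fun [set: X] g ->
  (forall x, `|f x| <= `|g x|)%R -> norm f <= norm g.
Proof.
move=> mf mg fg; have r0 := exponent_gt0.
rewrite !Lnorm_powRE; apply: gt0_ler_poweR.
- by rewrite invr_ge0 ltW.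
- by rewrite in_itv/= leey andbT integral_ge0.
- by rewrite in_itv/= leey andbT integral_ge0.
apply: ge0_le_integral => //; try exact: measurable_powr_abs.
by move=> x _; rewrite lee_fin ge0_ler_powR ?nnegrE// ltW.
Qed.

Lemma Lfun_le f g : measurable_fun [set: X] f -> g \in Lr ->
  (forall x, `|f x| <= `|g x|)%R -> f \in Lr.
Proof.
move=> mf /Lfun_normP[mg ng] fg; apply/Lfun_normP; split=> //.
exact: le_lt_trans (le_Lnorm mf mg fg) ng.
Qed.

Lemma abs_mul_indic_le f A x : (`|(f \* \1_A) x| <= `|f x|)%R.
Proof.
by rewrite /= indicE; case: (x \in A); rewrite ?mulr1// mulr0 normr0.
Qed.

Lemma measurable_mul_indic f A : measurable A -> measurable_fun [set: X] f ->
  measurable_fun [set: X] (f \* \1_A)%R.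
Proof. by move=> mA mf; apply: measurable_funM. Qed.

Lemma Lfun_restrict f A : measurable A -> f \in Lr -> (f \* \1_A)%R \in Lr.
Proof.
move=> mA fL; apply: (Lfun_le (g := f)) => //; last exact: abs_mul_indic_le.
by apply: measurable_mul_indic => //; case/Lfun_normP: fL.
Qed.

Lemma Lnorm_indic (p : R) A : (0 < p)%R -> measurable A ->
  'N[mu]_(p%:E)[EFin \o \1_A] = mu A `^ p^-1.
Proof.
move=> p0 mA; rewrite unlock; congr (_ `^ _).
have <- : \int[mu]_x (\1_A x)%:E = mu A by rewrite integral_indic// setIT.
apply: eq_integral => x _; rewrite /= indicE; congr EFin.
case: (x \in A); first by rewrite normr1 powR1.
by rewrite normr0 powR0// gt_eqF.
Qed.

Lemma Lfun_indic A : measurable A -> mu A < +oo -> \1_A \in Lr.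
Proof.
move=> mA Aoo; apply/Lfun_normP; split; first exact: measurable_indic.
by rewrite Lnorm_indic ?exponent_gt0// poweR_lty.
Qed.

Section on_a_set.
Variable A : set X.
Hypotheses (mA : measurable A) (A0 : 0 < mu A) (Aoo : mu A < +oo).

Let a := fine (mu A).

Lemma measure_fineK : mu A = a%:E.
Proof. by rewrite fineK// ge0_fin_numE. Qed.

Lemma measure_fine_gt0 : (0 < a)%R.
Proof. by rewrite fine_gt0// A0. Qed.

Lemma restrict_powr f x :
  ((fun y => (`|f y| `^ r)%:E) \_ A) x = (`|(f \* \1_A)%R x| `^ r)%:E.
Proof.
rewrite patchE /= indicE; case: (x \in A) => /=; first by rewrite mulr1.
by rewrite mulr0 normr0 powR0// gt_eqF// exponent_gt0.
Qed.

(** The r-mean over a set is a normalized norm of the restriction, so that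
    Minkowski's and Hoelder's inequalities apply to it. *)
Lemma avg_rE f : measurable_fun [set: X] f ->
  avg_r mu r A f = norm (f \* \1_A)%R * (a `^ (- r^-1))%:E.
Proof.
move=> mf; rewrite /avg_r Lnorm_powRE integral_mkcond.
under eq_integral do rewrite restrict_powr.
rewrite measure_fineK inver gt_eqF ?measure_fine_gt0// poweRM//.
- by rewrite poweR_EFin -(powR_inv1 (ltW measure_fine_gt0)) -powRrM mulN1r.
- by rewrite integral_ge0.
by rewrite lee_fin invr_ge0 ltW ?measure_fine_gt0.
Qed.

Lemma avg_r_ge0 f : 0 <= avg_r mu r A f.
Proof. exact: poweR_ge0. Qed.

Lemma le_avg_r f g : measurable_fun [set: X] f -> measurable_fun [set: X] g ->
  (forall x, A x -> `|f x| <= `|g x|)%R -> avg_r mu r A f <= avg_r mu r A g.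
Proof.
move=> mf mg fg; rewrite !avg_rE// lee_wpmul2r ?lee_fin ?powR_ge0//.
apply: le_Lnorm; try exact: measurable_mul_indic.
move=> x; rewrite /= indicE; have [|] := boolP (x \in A).
  by rewrite inE !mulr1 => /fg.
by rewrite !mulr0.
Qed.

Lemma avg_r_fin f : measurable_fun [set: X] f -> (f \* \1_A)%R \in Lr ->
  avg_r mu r A f \is a fin_num.
Proof.
move=> mf /Lfun_normP[_ fL]; rewrite avg_rE// fin_numM// ge0_fin_numE//.
exact: Lnorm_ge0.
Qed.

Lemma avg_r_triangle f g :
  measurable_fun [set: X] f -> measurable_fun [set: X] g ->
  avg_r mu r A (f \+ g)%R <= avg_r mu r A f + avg_r mu r A g.
Proof.
move=> mf mg; rewrite !avg_rE//; last exact: measurable_funD.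
rewrite -ge0_muleDl ?Lnorm_ge0// lee_wpmul2r ?lee_fin ?powR_ge0//.
have -> : ((f \+ g) \* \1_A = (f \* \1_A) \+ (g \* \1_A))%R.
  by apply/funext => x /=; rewrite mulrDl.
by apply: minkowski_EFin => //; exact: measurable_mul_indic.
Qed.

Lemma avg_r_cst c : avg_r mu r A (cst c) = `|c|%:E.
Proof.
rewrite /avg_r (_ : \int[mu]_(x in A) _ = (`|c| `^ r)%:E * mu A); last first.
  by rewrite -integral_cst.
rewrite measure_fineK inver gt_eqF ?measure_fine_gt0// -!EFinM -mulrA.
rewrite mulfV ?gt_eqF ?measure_fine_gt0// mulr1 poweR_EFin -powRrM.
by rewrite mulfV ?powRr1// gt_eqF// exponent_gt0.
Qed.

(** Hoelder's inequality against the indicator of [A]; for [r = 1] this is an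
    equality. *)
Lemma integral_abs_le_avg_r f : measurable_fun [set: X] f -> 
  \int[mu]_(x in A) `|f x|%:E <= avg_r mu r A f * mu A.
Proof.
move=> mf; have r0 := exponent_gt0; have a0 := measure_fine_gt0.
have mfA := measurable_mul_indic mA mf.
have -> : \int[mu]_(x in A) `|f x|%:E = 'N[mu]_1[EFin \o (f \* \1_A)%R].
  rewrite Lnorm1 integral_mkcond; apply: eq_integral => x _.
  rewrite patchE /= indicE; case: (x \in A) => /=; first by rewrite mulr1.
  by rewrite mulr0 normr0.
rewrite avg_rE//.
have /predU1P[r1|r1] : (1%R == r) || (1 < r)%R by rewrite -le_eqVlt.
  rewrite -r1 invr1 (powR_inv1 (ltW a0)) measure_fineK -muleA -EFinM.
  by rewrite mulVf ?gt_eqF// mule1.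
pose q := (1 - r^-1)^-1%R.
have q0 : (0 < q)%R by rewrite invr_gt0 subr_gt0 invf_lt1.
have := @hoelder _ _ _ mu (f \* \1_A)%R \1_A r q mfA.
move=> /(_ (measurable_indic mA) r0 q0).
rewrite /q invrK subrKC => /(_ erefl).
have -> : ((f \* \1_A) \* \1_A = f \* \1_A)%R.
  apply/funext => x /=; rewrite -mulrA indicE.
  by case: (x \in A); rewrite ?mulr1 ?mulr0.
move=> /le_trans; apply.
rewrite Lnorm_indic// invrK.
rewrite -muleA measure_fineK -EFinM poweR_EFin -{3}(powRr1 (ltW a0)).
rewrite -powRD; last first.
  by rewrite (gt_eqF a0) implybT.
by rewrite addrC.
Qed.

End on_a_set.

End Lp_norms.

Section averages_on_a_set.
Context d (X : measurableType d) (R : realType).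
Variables (mu : {measure set X -> \bar R}) (r : R).
Hypothesis hr : (1 <= r)%R.
Notation Lr := (Lfun mu r%:E).
Notation norm f := ('N[mu]_(r%:E)[EFin \o f]).
Implicit Types (f g : X -> R).
Variable A : set X.
Hypotheses (mA : measurable A) (A0 : 0 < mu A) (Aoo : mu A < +oo).

Lemma Lnorm_restrictE f : measurable_fun [set: X] f ->
  norm (f \* \1_A)%R = avg_r mu r A f * (fine (mu A) `^ r^-1)%:E.
Proof.
move=> mf; have a0 := measure_fine_gt0 A0 Aoo.
rewrite (avg_rE hr A0 Aoo) // -muleA -EFinM -powRD ?(gt_eqF a0) ?implybT//.
by rewrite addNr powRr0 mule1.
Qed.

Lemma avg_r_le_norm f : f \in Lr ->
  avg_r mu r A f <= norm f * (fine (mu A) `^ (- r^-1))%:E.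
Proof.
move=> /Lfun_normP[mf _]; rewrite (avg_rE hr A0 Aoo)//.
rewrite lee_wpmul2r ?lee_fin ?powR_ge0//.
apply: (le_Lnorm mu hr) => //; first exact: measurable_mul_indic.
exact: abs_mul_indic_le.
Qed.

(** The constant is [k `^ r^-1]; it is weakened to [k] because [1 <= k] and
    [1 <= r]. *)
Lemma avg_r_subset f A' (k : R) : measurable_fun [set: X] f ->
  measurable A' -> mu A' < +oo -> A `<=` A' -> (1 <= k)%R ->
  mu A' <= k%:E * mu A -> avg_r mu r A f <= k%:E * avg_r mu r A' f.
Proof.
move=> mf mA' A'oo AA' k1 kA; have r0 := exponent_gt0 hr.
have A'0 : 0 < mu A' by rewrite (lt_le_trans A0)// le_measure ?inE.
have a0 := measure_fine_gt0 A0 Aoo; have a'0 := measure_fine_gt0 A'0 A'oo.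
rewrite (avg_rE hr A0 Aoo)// (avg_rE hr A'0 A'oo)// muleCA.
apply: lee_pmul; rewrite ?Lnorm_ge0 ?lee_fin ?powR_ge0//.
  apply: (le_Lnorm mu hr) => //; try exact: measurable_mul_indic.
  move=> x; rewrite /= !indicE; have [|_] := boolP (x \in A); last first.
    by rewrite mulr0 normr0.
  by rewrite inE => /AA' A'x; rewrite mem_set.
have k0 : (0 < k)%R by rewrite (lt_le_trans _ k1).
have kaa : (fine (mu A') <= k * fine (mu A))%R.
  by move: kA; rewrite (measure_fineK Aoo) (measure_fineK A'oo).
rewrite -?EFinM ?lee_fin.
have : (fine (mu A) `^ (- r^-1) <= k `^ r^-1 * fine (mu A') `^ (- r^-1))%R.
  rewrite !powRN ler_pdivlMr ?powR_gt0// mulrC ler_pdivrMr ?powR_gt0//.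
  rewrite -(powRM _ (ltW k0) (ltW a0)).
  by apply: ge0_ler_powR => //; rewrite ?nnegrE ?invr_ge0 ?mulr_ge0 ?ltW.
move=> /le_trans; apply; rewrite ler_wpM2r ?powR_ge0//.
rewrite -{2}(powRr1 (ltW k0)) ler_powR// invf_le1//.
Qed.

Lemma integrable_on f : measurable_fun [set: X] f -> (f \* \1_A)%R \in Lr ->
  mu.-integrable A (EFin \o f).
Proof.
move=> mf fL; apply/integrableP; split.
  apply/measurable_EFinP; exact: measurable_funS mf.
apply: (le_lt_trans (integral_abs_le_avg_r hr mA A0 Aoo mf)).
rewrite (measure_fineK Aoo) ltey_eq fin_numM//.
by apply: avg_r_fin => //.
Qed.

(** Jensen's inequality for the mean of [f - c]. *)
Lemma avg_dist f c : measurable_fun [set: X] f -> (f \* \1_A)%R \in Lr ->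
  `|avg mu A f - c|%:E <= avg_r mu r A (fun x => f x - c)%R.
Proof.
move=> mf fL; have a0 := measure_fine_gt0 A0 Aoo.
have If := integrable_on mf fL.
have Ic : mu.-integrable A (EFin \o cst c).
  apply: measurable_bounded_integrable => //.
  by exists `|c|%R; split=> [|y cy x _ /=]; [exact: num_real|exact: ltW].
have mfc : measurable_fun [set: X] (fun x => f x - c)%R.
  exact: measurable_funB.
have -> : (avg mu A f - c = (\int[mu]_(x in A) (f x - c)) / fine (mu A))%R.
  rewrite (@RintegralB _ _ _ mu A f (cst c))//.
  by rewrite Rintegral_cst// /avg mulrBl mulfK// gt_eqF.
rewrite normrM normfV (gtr0_norm a0) EFinM.
rewrite -(@lee_pmul2r _ (fine (mu A))%:E)// -muleA -EFinM mulVf ?gt_eqF// mulr1.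
rewrite -(measure_fineK Aoo).
apply: le_trans (integral_abs_le_avg_r hr mA A0 Aoo mfc).
have Ifc : mu.-integrable A (EFin \o (fun x => f x - c)%R).
  by apply: eq_integrable (integrableB mA If Ic) => //.
have := le_normr_Rintegral mA Ifc; rewrite -lee_fin => /le_trans; apply.
rewrite /Rintegral fineK//.
exact: (integrable_fin_num mA (integrable_abse Ifc)).
Qed.

End averages_on_a_set.

(** * Geometry of a ball-basis *)

(** The default [x0] fills the gaps of the enumeration, so that [S] may be
    empty. *)
Lemma countable_enumeration (T : choiceType) (S : set T) (x0 : T) :
  countable S -> exists u : nat -> T,
    (forall n, S (u n) \/ u n = x0) /\ (forall x, S x -> exists n, u n = x).
Proof.
move=> /countable_injP[h hinj].
exists (fun n => xget x0 [set x | S x /\ h x = n]); split=> [n|x Sx].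
  by case: xgetP => [x -> [Sx _]|_]; [left|right].
exists (h x); case: xgetP => [y -> [Sy hy]|/(_ x)[]//].
by apply: hinj; rewrite ?inE.
Qed.

Section ball_geometry.
Context d (X : measurableType d) (R : realType).
Variables (mu : {measure set X -> \bar R}).
Variables (balls : set (set X)) (hull : set X -> set X).
Hypothesis bb : ball_basis mu balls hull.
Implicit Types (A B D : set X).

Lemma touching_ball_sub_hull A B : balls A -> balls B -> A `&` B !=set0 ->
  mu A <= 2%:E * mu B -> A `<=` hull B.
Proof.
move=> bA bB AB muAB x Ax; apply: (hull_sub bb bB).
by exists A.
Qed.

Lemma ball_neq0 B : balls B -> B !=set0.
Proof.
move=> bB; apply/set0P/negP => /eqP B0.
by have := ball_pos bb bB; rewrite B0 measure0 ltxx.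
Qed.

Lemma le_double A : mu A <= 2%:E * mu A.
Proof. by rewrite lee_pemull// lee_fin ler1n. Qed.

Lemma ball_sub_hull B : balls B -> B `<=` hull B.
Proof.
move=> bB; apply: touching_ball_sub_hull => //; last exact: le_double.
by rewrite setIid; exact: ball_neq0.
Qed.

(** The hull of the larger ball contains both. *)
Lemma touching_balls_join A B : balls A -> balls B -> A `&` B !=set0 ->
  exists D, [/\ balls D, A `<=` D & B `<=` D].
Proof.
wlog AB : A B / mu A <= mu B.
  move=> H bA bB AB; have [/H|/ltW/H] := leP (mu A) (mu B); first exact.
  by rewrite setIC in AB => /(_ bB bA AB)[D [? ? ?]]; exists D.
move=> bA bB ABn0; exists (hull B); split; first exact: hull_ball bb _ bB.
- apply: touching_ball_sub_hull => //; exact: le_trans AB (le_double B).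
- exact: ball_sub_hull.
Qed.

(** Link [A] and [B] by a ball through a point of each, then join touching balls
    twice. *)
Lemma balls_directed A B : balls A -> balls B ->
  exists D, [/\ balls D, A `<=` D & B `<=` D].
Proof.
move=> bA bB; have [x Ax] := ball_neq0 bA; have [y By] := ball_neq0 bB.
have [C [bC Cx Cy]] := ball_pair bb x y.
have [D [bD AD CD]] : exists D, [/\ balls D, A `<=` D & C `<=` D].
  by apply: touching_balls_join => //; exists x.
have [E [bE DE BE]] : exists E, [/\ balls E, D `<=` E & B `<=` E].
  by apply: touching_balls_join => //; exists y; split=> //; exact: CD.
by exists E; split=> //; exact: subset_trans DE.
Qed.

(** Approximate [X] itself up to [1 / (n + 1)] for every [n], and collect all
    the balls used. *)
Lemma countable_balls_conegligible : exists S : set (set X),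
  [/\ countable S, S `<=` balls & mu.-negligible (~` \bigcup_(B in S) B)].
Proof.
have /choice[S HS] n : exists S : set (set X), [/\ countable S, S `<=` balls &
    mu ([set: X] `+` \bigcup_(B in S) B) < (n.+1%:R^-1)%:E].
  by apply: (ball_approx bb) => //; rewrite invr_gt0.
have bS n : S n `<=` balls by have [] := HS n.
have cS n : countable (S n) by have [] := HS n.
exists (\bigcup_n S n); split.
- by apply: bigcup_countable => // n _; exact: cS.
- by move=> B [n _ /bS].
have mS n : measurable (~` \bigcup_(B in S n) B).
  apply: measurableC; have [u [Su uS]] := countable_enumeration set0 (cS n).
  rewrite (_ : \bigcup_(B in S n) B = \bigcup_k u k).
    apply: bigcupT_measurable => k; have [/bS|->] := Su k; last by [].
    exact: ball_measurable bb _.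
  apply/seteqP; split=> x [].
    by move=> B /uS[k <-] ukx; exists k.
  by move=> k _; have [Suk ukx|->] := Su k; [exists (u k)|].
exists (\bigcap_n ~` \bigcup_(B in S n) B); split.
- exact: bigcapT_measurable.
- apply/eqP; rewrite -measure_le0; apply/lee_addgt0Pr => e e0; rewrite add0e.
  have [n ne] : exists n, (n.+1%:R^-1 < e)%R.
    exists (Num.truncn e^-1); rewrite invf_plt ?posrE//.
    exact: truncnS_gt.
  apply: (@le_trans _ _ (mu (~` \bigcup_(B in S n) B))).
    apply: le_measure; rewrite ?inE//; first exact: bigcapT_measurable.
    by move=> x; apply.
  have [_ _] := HS n.
  rewrite (_ : [set: X] `+` _ = ~` \bigcup_(B in S n) B); last first.
    by rewrite /setY setTD setDT setU0.
  by move=> /ltW/le_trans; apply; rewrite lee_fin ltW.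
move=> x nx n _ [B SB Bx]; apply: nx; exists B => //; by exists n.
Qed.

Lemma ball_exhaustion B0 : balls B0 -> exists G : nat -> set X,
  [/\ forall n, balls (G n), forall n, B0 `<=` G n, nondecreasing_seq G &
      mu.-negligible (~` \bigcup_n G n)].
Proof.
move=> bB0.
have /choice[join Hj] (AB : set X * set X) : exists D,
    balls AB.1 -> balls AB.2 -> [/\ balls D, AB.1 `<=` D & AB.2 `<=` D].
  have [[bA bB]|nb] := pselect (balls AB.1 /\ balls AB.2).
    by have [D HD] := balls_directed bA bB; exists D.
  by exists set0 => bA bB; exfalso; apply: nb.
have [S [cS Sb negS]] := countable_balls_conegligible.
have [e [Se eS]] := countable_enumeration B0 cS.
have be n : balls (e n) by have [/Sb|->] := Se n.
pose G := fix G n := if n is m.+1 then join (G m, e m) else B0.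
have bG n : balls (G n).
  by elim: n => [//|n IHn] /=; have [] := Hj (G n, e n) IHn (be n).
have GS n : G n `<=` G n.+1 by have [] := Hj (G n, e n) (bG n) (be n).
have eG n : e n `<=` G n.+1 by have [] := Hj (G n, e n) (bG n) (be n).
have Gnd : nondecreasing_seq G.
  by apply/nondecreasing_seqP => n; apply/subsetPset.
exists G; split=> //.
  by move=> n; have /subsetPset := Gnd 0%N n isT.
apply: negligibleS negS => x nGx [B SB Bx]; apply: nGx.
by have [n enB] := eS B SB; exists n.+1 => //; apply: eG; rewrite enB.
Qed.

Variables (r : R).
Hypothesis hr : (1 <= r)%R.
Notation Lr := (Lfun mu r%:E).
Notation norm f := ('N[mu]_(r%:E)[EFin \o f]).

(** Dominated convergence along an exhausting sequence of balls. *)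
Lemma norm_outside_ball f B0 (e : R) : f \in Lr -> balls B0 -> (0 < e)%R ->
  exists G, [/\ balls G, B0 `<=` G & norm (f \* \1_(~` G))%R <= e%:E].
Proof.
move=> fL bB0 e0; have r0 := exponent_gt0 hr.
have [G [bG B0G Gnd negG]] := ball_exhaustion bB0.
have [mf _] := (Lfun_normP mu r f).1 fL.
have mG n : measurable (~` G n).
  by apply: measurableC; exact: ball_measurable bb _ (bG n).
pose f_ n x := (`|(f \* \1_(~` G n))%R x| `^ r)%:E.
have mf_ n : measurable_fun [set: X] (f_ n).
  by apply: measurable_powr_abs; exact: measurable_mul_indic.
have [] := @dominated_convergence _ _ _ mu _ measurableT f_ (cst 0)
  (fun x => (`|f x| `^ r)%:E) mf_.
- exact: measurable_cst.
- apply: negligibleS negG => x /= nx [n _ Gnx]; apply: nx => _.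
  apply: cvg_near_cst; exists n => // m /= nm.
  rewrite /f_ /= indicE memNset; first by rewrite mulr0 normr0 powR0// gt_eqF.
  by move=> /=; apply; move: x Gnx; apply/subsetPset; exact: Gnd.
- exact: Lfun_integrable.
- apply: nearW => x n _; rewrite /f_ gee0_abs ?lee_fin ?powR_ge0//.
  apply: ge0_ler_powR; rewrite ?nnegrE //; [exact: ltW|exact: abs_mul_indic_le].
move=> _ _; rewrite integral0 => Hcvg.
have er0 : 0 < (e `^ r)%:E by rewrite lte_fin powR_gt0.
have [n Hle] : exists n, \int[mu]_x f_ n x <= (e `^ r)%:E.
  apply: contrapT => /forallNP Hn; suff : (e `^ r)%:E <= 0 by rewrite leNgt er0.
  apply: (cvge_to_ge Hcvg); apply: nearW => n /=; apply: ltW.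
  by rewrite ltNge; apply/negP; exact: Hn.
exists (G n); split=> //; rewrite Lnorm_powRE.
rewrite -(powRr1 (ltW e0)) -(@mulfV _ r) ?gt_eqF// powRrM -poweR_EFin.
apply: gt0_ler_poweR => //;
  by rewrite ?invr_ge0 ?in_itv/= ?leey ?andbT ?integral_ge0 ?lee_fin ?powR_ge0
    ?ltW.
Qed.

End ball_geometry.

(** * Logarithmic growth of means *)

Section log_weight.
Context (R : realType).
Implicit Types (t : R) (k : nat).

Lemma omega_log_ge0 t : (0 <= t)%R -> (0 <= omega_log t)%R.
Proof.
move=> t0; rewrite /omega_log invr_ge0 divr_ge0// ?ln_ge0// ?lerDl//.
Qed.

(** Since [k <= log_2 t <= log_2 (1 + t)] and [1 <= log_2 (1 + t)], the weight
    absorbs [k] at the cost of [1], and the constant [3] at the cost of [3]. *)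
Lemma omega_log_weight t k : (2 ^+ k <= t)%R ->
  ((k + 3)%:R * omega_log t <= 4 :> R)%R.
Proof.
move=> kt; have l2 : (0 < ln 2 :> R)%R by rewrite ln_gt0// ltr1n.
have t1 : (1 <= t)%R by rewrite (le_trans _ kt)// exprn_ege1// ler1n.
have h1 : (ln 2 <= ln (1 + t))%R by rewrite ler_ln ?posrE; lra.
have hk : (k%:R * ln 2 <= ln (1 + t))%R.
  rewrite mulr_natl -lnXn//; rewrite ler_ln ?posrE ?exprn_gt0//; lra.
rewrite /omega_log invf_div mulrA ler_pdivrMr; last exact: lt_le_trans h1.
rewrite natrD; lra.
Qed.

End log_weight.

Section mean_growth.
Context d (X : measurableType d) (R : realType).
Variables (mu : {measure set X -> \bar R}).
Variables (balls : set (set X)) (hull : set X -> set X).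
Hypothesis bb : ball_basis mu balls hull.
Local Notation m A := (fine (mu A)).
Variables K eta : R.
Hypothesis K1 : (1 <= K)%R.
Hypothesis hullK : forall B, balls B -> mu (hull B) <= K%:E * mu B.
Hypothesis eta2 : (2 < eta)%R.
Hypothesis dbl : forall B, balls B -> hull B <> [set: X] ->
  exists B', [/\ balls B', B `<=` B',
                 2%:E * mu B <= mu B' & mu B' <= eta%:E * mu B].
Variables (r : R).
Hypothesis hr : (1 <= r)%R.
Notation Lr := (Lfun mu r%:E).
Implicit Types (A B D : set X).

Lemma ball_fineE A : balls A -> mu A = (m A)%:E.
Proof. by move=> bA; apply: measure_fineK; exact: ball_fin bb _ bA. Qed.

Lemma ball_fine_gt0 A : balls A -> (0 < m A)%R.
Proof.
move=> bA; apply: measure_fine_gt0; first exact: ball_pos bb _ bA.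
exact: ball_fin bb _ bA.
Qed.

Lemma ball_fine_le A B (k : R) : balls A -> balls B ->
  (mu A <= k%:E * mu B) = (m A <= k * m B)%R.
Proof.
by move=> bA bB; rewrite (ball_fineE bA) (ball_fineE bB) -EFinM lee_fin.
Qed.

Lemma ball_fine_subset A B : balls A -> balls B -> A `<=` B -> (m A <= m B)%R.
Proof.
move=> bA bB AB; rewrite -lee_fin -(ball_fineE bA) -(ball_fineE bB).
by apply: le_measure; rewrite ?inE//; apply: (ball_measurable bb).
Qed.

Lemma hull_fine_le A : balls A -> (m (hull A) <= K * m A)%R.
Proof.
by move=> bA; rewrite -ball_fine_le//; [exact: hullK|exact: hull_ball bb _ bA].
Qed.

Lemma Lfun_sub_cst f (c : R) A : f \in Lr -> balls A ->
  ((fun x => f x - c) \* \1_A)%R \in Lr.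
Proof.
move=> fL bA; have mA := ball_measurable bb bA.
have r1 : 1 <= r%:E by rewrite lee_fin.
rewrite (_ : (_ \* _)%R = (- c) *: (\1_A : X -> R) + (f \* \1_A)%R)%R.
  apply: (Lfun_submod_closed mu r1).2; last exact: Lfun_restrict.
  by apply: Lfun_indic => //; exact: ball_fin bb _ bA.
apply/funext => x; transitivity (- c * \1_A x + f x * \1_A x)%R; last by [].
by rewrite /= mulrBl addrC mulNr.
Qed.

Variable f : X -> R.
Hypothesis fL : f \in Lr.

Lemma Lr_measurable : measurable_fun [set: X] f.
Proof. by have [] := (Lfun_normP mu r f).1 fL. Qed.

Lemma measurable_sub_cst c : measurable_fun [set: X] (fun x => f x - c)%R.
Proof. by apply: measurable_funB => //; exact: Lr_measurable. Qed.

(** One step of the chain: by Jensen's inequality, the mean over [A] differs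
    from that over [A'] by at most the r-mean over [A] of [f - f_A'], and
    passing from [A] to [A'] costs the ratio of the measures. *)
Lemma avg_nested A A' (k M : R) : balls A -> balls A' -> A `<=` A' ->
  (1 <= k)%R -> (m A' <= k * m A)%R -> avg_sharp mu r A' f <= M%:E ->
  (`|avg mu A f - avg mu A' f| <= k * M)%R.
Proof.
move=> bA bA' AA' k1 mk sM; have mf := Lr_measurable.
have mA := ball_measurable bb bA; have mA' := ball_measurable bb bA'.
have A0 := ball_pos bb bA; have Aoo := ball_fin bb bA.
have fA := Lfun_restrict hr mA fL.
rewrite -lee_fin; apply: (le_trans (avg_dist hr mA A0 Aoo _ mf fA)).
apply: (le_trans (avg_r_subset (A' := A') hr mA A0 Aoo _ _ _ AA' k1 _)) => //.
- exact: measurable_sub_cst.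
- exact: ball_fin bb _ bA'.
- by rewrite ball_fine_le.
by rewrite EFinM lee_wpmul2l// lee_fin; lra.
Qed.

Variables (B : set X) (M : R).
Hypothesis bB : balls B.
Hypothesis sharpM : forall A, balls A -> B `<=` A -> avg_sharp mu r A f <= M%:E.

Lemma sharp_bound_ge0 : (0 <= M)%R.
Proof. by rewrite -lee_fin (le_trans _ (sharpM bB _))//; exact: avg_r_ge0. Qed.

Lemma avg_common_superball A D E (k : R) : balls A -> balls D -> balls E ->
  B `<=` A -> A `<=` E -> D `<=` E -> (1 <= k)%R ->
  (m E <= k * m A)%R -> (m E <= k * m D)%R ->
  (`|avg mu A f - avg mu D f| <= 2 * (k * M))%R.
Proof.
move=> bA bD bE BA AE DE k1 kA kD.
have sE : avg_sharp mu r E f <= M%:E.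
  by apply: sharpM => //; exact: subset_trans AE.
have h1 := avg_nested bA bE AE k1 kA sE.
have h2 := avg_nested bD bE DE k1 kD sE.
rewrite distrC in h2.
have := ler_distD (avg mu E f) (avg mu A f) (avg mu D f); lra.
Qed.

(** Starting from [D], pass to doubling balls as long as their measure does not
    exceed that of [A].  The last ball has measure comparable to [A] and touches
    [A], so its hull, or the hull of its double, contains [A].  Each step
    doubles the measure, which bounds the number [k] of steps.  The integer [n]
    only makes the induction well founded. *)
Lemma avg_chain A (n : nat) D : balls A -> B `<=` A -> balls D -> B `<=` D ->
  (m D <= m A)%R -> (m A < 2 ^+ n * m D)%R ->
  exists k : nat, (2 ^+ k * m D <= m A)%R /\
    (`|avg mu A f - avg mu D f| <= (k + 2)%:R * (K * eta * M))%R.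
Proof.
move=> bA BA; have M0 := sharp_bound_ge0; have K1' := K1; have eta2' := eta2.
have [b Bb] := ball_neq0 bb bB.
have Ke : (K <= K * eta)%R by rewrite ler_peMr//; lra.
have KeM : (K * M <= K * eta * M)%R by rewrite ler_wpM2r.
have KeM0 : (0 <= K * eta * M)%R by rewrite !mulr_ge0//; lra.
elim: n D => [|n IHn] D bD BD DA An; first by rewrite mul1r in An; lra.
have mA0 := ball_fine_gt0 bA; have mD0 := ball_fine_gt0 bD.
have [hX|hX] := pselect (hull D = [set: X]).
  have bH := hull_ball bb bD; have mH := hull_fine_le bD.
  exists 0%N; split; first by rewrite expr0 mul1r.
  have := @avg_common_superball A D (hull D) K bA bD bH BA.
  rewrite {1 2}hX => /(_ (@subsetT _ _) (@subsetT _ _) K1).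
  have : (K * m D <= K * m A)%R by rewrite ler_wpM2l//; lra.
  move=> KDA; rewrite addnC addn0 => /(_ (le_trans mH KDA) mH); lra.
have [D' [bD' DD' D2 De]] := dbl bD hX.
have {}D2 : (2 * m D <= m D')%R.
  by rewrite -lee_fin EFinM -(ball_fineE bD) -(ball_fineE bD').
have {}De : (m D' <= eta * m D)%R by rewrite -ball_fine_le.
have [D'A|AD'] := leP (m D') (m A).
  have [||k [kA kM]] := IHn D' bD' _ D'A.
  - exact: subset_trans DD'.
  - rewrite (lt_le_trans An)// exprSr -mulrA ler_wpM2l// exprn_ge0//.
  exists k.+1; split.
    by rewrite exprSr -mulrA (le_trans _ kA)// ler_wpM2l// exprn_ge0.
  have sD' : avg_sharp mu r D' f <= M%:E.
    by apply: sharpM => //; exact: subset_trans DD'.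
  have e1 : (1 <= eta)%R by lra.
  have := avg_nested bD bD' DD' e1 De sD'; rewrite distrC => h2.
  have := ler_distD (avg mu D' f) (avg mu A f) (avg mu D f).
  have : (eta * M <= K * eta * M)%R by rewrite ler_wpM2r// ler_peMl; lra.
  move: kM; rewrite addSn -[(k + 2).+1]addn1 (natrD _ (k + 2)); lra.
have bH := hull_ball bb bD'; have mH := hull_fine_le bD'.
exists 0%N; split; first by rewrite expr0 mul1r.
have Ke1 : (1 <= K * eta)%R by lra.
rewrite addnC addn0.
have KD' : (K * m D' <= K * (eta * m D))%R by rewrite ler_wpM2l//; lra.
have KDA : (K * (eta * m D) <= K * (eta * m A))%R.
  rewrite ler_wpM2l ?ler_wpM2l//; lra.
apply: (avg_common_superball bA bD bH BA _ _ Ke1).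
- apply: (touching_ball_sub_hull bb) => //.
    by exists b; split; [exact: BA|exact/DD'/BD].
  by rewrite ball_fine_le//; have := ball_fine_gt0 bD'; lra.
- exact: subset_trans DD' (ball_sub_hull bb bD').
- rewrite -mulrA; lra.
- rewrite -mulrA; lra.
Qed.

(** The left-hand side is the quantity in the BO condition applied to [f - f_B];
    the logarithm gained along the chain is cancelled by the weight. *)
Lemma log_growth A : balls A -> B `<=` A ->
  (omega_log (m A / m B))%:E * avg_r mu r A (fun x => f x - avg mu B f)%R
    <= (4 * (K * eta * M))%:E.
Proof.
move=> bA BA; have M0 := sharp_bound_ge0; have K1' := K1; have eta2' := eta2.
have mA0 := ball_fine_gt0 bA; have mB0 := ball_fine_gt0 bB.
have BAm := ball_fine_subset bB bA BA.
have [n An] : exists n, (m A < 2 ^+ n * m B)%R.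
  exists (Num.truncn (m A / m B)).+1; rewrite -ltr_pdivrMr//.
  apply: (lt_trans (truncnS_gt _)); rewrite -natrX ltr_nat; exact: ltn_expl.
have [k [kA kM]] := avg_chain bA BA bB (@subset_refl _ B) BAm An.
have A0 := ball_pos bb bA; have Aoo := ball_fin bb bA.
have KeM : (M <= K * eta * M)%R.
  by rewrite ler_peMl// -[leLHS]mulr1 ler_pM; lra.
have hA : avg_r mu r A (fun x => f x - avg mu B f)%R <=
    ((k + 3)%:R * (K * eta * M))%:E.
  rewrite (_ : (fun x => f x - avg mu B f) = (fun x => f x - avg mu A f) \+
      cst (avg mu A f - avg mu B f))%R; last first.
    by apply/funext => x /=; rewrite addrA subrK.
  apply: le_trans.
    apply: (avg_r_triangle hr (ball_measurable bb bA) A0 Aoo) => //.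
    exact: measurable_sub_cst.
  rewrite (avg_r_cst hr (ball_measurable bb bA) A0 Aoo).
  apply: (@le_trans _ _ (M%:E + ((k + 2)%:R * (K * eta * M))%:E)).
    by rewrite leeD ?lee_fin//; exact: sharpM.
  rewrite -EFinD lee_fin.
  have -> : ((k + 3)%:R = (k + 2)%:R + 1 :> R)%R by rewrite natr1 -addnS.
  by rewrite mulrDl mul1r addrC lerD2l.
have w0 : (0 <= omega_log (m A / m B))%R.
  by rewrite omega_log_ge0 ?divr_ge0 ?ltW.
apply: (le_trans (lee_wpmul2l _ hA)); first by rewrite lee_fin.
rewrite -EFinM lee_fin [leLHS]mulrA ler_wpM2r//; first lra.
rewrite mulrC; apply: omega_log_weight.
by rewrite ler_pdivlMr.
Qed.

End mean_growth.

(** * The far part *)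

Section oscillation.
Context d (X : measurableType d) (R : realType).
Variables (mu : {measure set X -> \bar R}).
Implicit Types (E : set X) (F G H : X -> \bar R) (s t : R).

(** A pointwise form of [osc_on E F <= s%:E], convenient for combining
    oscillation bounds with pointwise identities. *)
Definition osc_le E F s :=
  forall x x', E x -> E x' -> `|F x - F x'| <= s%:E.

(** Taking [x = x'] is informative: the difference of an infinite value with
    itself has absolute value [+oo]. *)
Lemma osc_le_fin E F s x : osc_le E F s -> E x -> F x \is a fin_num.
Proof. by move=> /(_ x x) + Ex => /(_ Ex Ex); case: (F x). Qed.

Lemma osc_le_subset E E' F s : E' `<=` E -> osc_le E F s -> osc_le E' F s.
Proof. by move=> EE' h x x' /EE' Ex /EE'; exact: h. Qed.

Lemma osc_leP E F s : OSC mu E F <= s%:E <->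
  exists2 N, mu.-negligible N & osc_le (E `\` N) F s.
Proof.
split=> [Fs|[N negN Fs]].
  have [N negN NF] := OSC_attained mu E F; exists N => // x x' Ex Ex'.
  apply: le_trans (le_trans NF Fs); apply: ereal_sup_ubound.
  by exists x, x'.
apply: (@le_trans _ _ (osc_on (E `\` N) F)).
  by apply: ereal_inf_lbound; exists N.
by apply/ereal_supP => y [x [x' [Ex Ex' ->]]]; exact: Fs.
Qed.

Lemma ae_off (P : X -> Prop) : {ae mu, forall x, P x} ->
  exists2 N, mu.-negligible N & forall x, ~ N x -> P x.
Proof.
by move=> aeP; exists (~` [set x | P x]) => // x nx; apply: contrapT => /nx.
Qed.

Lemma osc_le_lin E F G H (a : R) s t : osc_le E G s -> osc_le E H t ->
  (forall x, E x -> F x = a%:E * G x + H x) -> osc_le E F (`|a| * s + t)%R.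
Proof.
move=> Gs Ht FE x x' Ex Ex'; rewrite !FE//.
have := Gs x x' Ex Ex'; have := Ht x x' Ex Ex'.
have := osc_le_fin Gs Ex; have := osc_le_fin Gs Ex'.
have := osc_le_fin Ht Ex; have := osc_le_fin Ht Ex'.
case: (G x) => // g; case: (G x') => // g'.
case: (H x) => // h; case: (H x') => // h' _ _ _ _.
rewrite /= !lee_fin => hh gg.
have -> : (a * g + h - (a * g' + h') = a * (g - g') + (h - h'))%R by ring.
rewrite (le_trans (ler_normD _ _))// lerD// normrM ler_wpM2l//.
Qed.

End oscillation.

Section far_part.
Context d (X : measurableType d) (R : realType).
Variables (mu : {measure set X -> \bar R}).
Variables (balls : set (set X)) (hull : set X -> set X).
Hypothesis bb : ball_basis mu balls hull.
Local Notation m A := (fine (mu A)).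
Variables K eta : R.
Hypothesis K1 : (1 <= K)%R.
Hypothesis hullK : forall B, balls B -> mu (hull B) <= K%:E * mu B.
Hypothesis eta2 : (2 < eta)%R.
Hypothesis dbl : forall B, balls B -> hull B <> [set: X] ->
  exists B', [/\ balls B', B `<=` B',
                 2%:E * mu B <= mu B' & mu B' <= eta%:E * mu B].
Variables (r : R).
Hypothesis hr : (1 <= r)%R.
Notation Lr := (Lfun mu r%:E).
Notation norm f := ('N[mu]_(r%:E)[EFin \o f]).
Implicit Types (A B D : set X).

Variables (T : (X -> R) -> (X -> \bar R)) (L : R).
Hypothesis linT : linear_op mu r T.
Hypothesis L0 : (0 <= L)%R.
Hypothesis TL : BO_bound mu r balls hull (@omega_log R) T L.

Lemma BO_bound_le B g s : g \in Lr -> balls B ->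
  (forall A, balls A -> B `<=` A ->
    (omega_log (m A / m B))%:E * avg_r mu r A g <= s%:E) ->
  OSC mu B (T (g \* \1_(~` hull B))%R) <= (L * s)%:E.
Proof.
move=> gL bB gs; apply: (le_trans (TL gL bB)).
rewrite EFinM lee_wpmul2l ?lee_fin//.
by apply/ereal_supP => y [A [bA BA] <-]; exact: gs.
Qed.

(** Each r-mean of [g 1_(~` G)] over a ball [A] containing [B] is at most the
    norm times [(mu A)^(-1/r)], hence at most [e].  The factor [2] bounds the
    weight [omega], which is at most [4/3]. *)
Lemma OSC_outer_part B G (g : X -> R) (e : R) : g \in Lr -> balls B ->
  norm (g \* \1_(~` G))%R <= (e * m B `^ r^-1)%:E ->
  (g \* \1_(~` G))%R \in Lr ->
  OSC mu B (T ((g \* \1_(~` G)) \* \1_(~` hull B))%R) <= (L * (2 * e))%:E.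
Proof.
move=> gL bB ge gGL; apply: BO_bound_le => // A bA BA.
have mB0 := ball_fine_gt0 bb bB; have mA0 := ball_fine_gt0 bb bA.
have BAm := ball_fine_subset bb bB bA BA.
have r0 := exponent_gt0 hr.
have e0 : (0 <= e)%R.
  rewrite -(pmulr_lge0 _ (powR_gt0 r^-1 mB0)) -lee_fin (le_trans _ ge)//.
  exact: Lnorm_ge0.
have h : avg_r mu r A (g \* \1_(~` G))%R <= e%:E.
  apply: (le_trans (avg_r_le_norm hr (ball_measurable bb bA) (ball_pos bb bA)
    (ball_fin bb bA) gGL)).
  apply: (le_trans (lee_wpmul2r _ ge)); first by rewrite lee_fin powR_ge0.
  rewrite -EFinM lee_fin powRN ler_pdivrMr ?powR_gt0// ler_wpM2l//.
  by apply: ge0_ler_powR; rewrite ?nnegrE ?invr_ge0// ltW.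
have t1 : (1 <= m A / m B)%R by rewrite ler_pdivlMr// mul1r.
have w0 : (0 <= omega_log (m A / m B))%R.
  by rewrite omega_log_ge0 ?divr_ge0 ?ltW.
have w3 : (3 * omega_log (m A / m B) <= 4)%R.
  by have := @omega_log_weight R _ 0%N t1.
apply: (le_trans (lee_wpmul2l _ h)); first by rewrite lee_fin.
by rewrite -EFinM lee_fin ler_wpM2r//; lra.
Qed.

Hypothesis vanT : forall B (e : R), balls B -> (0 < e)%R ->
  exists B', [/\ balls B', B `<=` B' &
    forall B'', balls B'' -> B' `<=` B'' -> OSC mu B (T \1_B'') <= e%:E].

Variables (f : X -> R) (B : set X) (M : R).
Hypothesis fL : f \in Lr.
Hypothesis bB : balls B.
Hypothesis sharpM : forall A, balls A -> B `<=` A -> avg_sharp mu r A f <= M%:E.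

Let c := avg mu B f.
(** The part of [f] for which only weak-type information is available; the
    subtraction of the mean makes its norm comparable to the sharp means. *)
Definition near_part : X -> R := ((fun x => f x - c) \* \1_(hull B))%R.
Definition far_part : X -> R := (f \- near_part)%R.

Section truncation.
Variable G : set X.
Definition middle_part : X -> R :=
  (((fun x => f x - c) \* \1_G) \* \1_(~` hull B))%R.
Definition outer_part : X -> R := ((f \* \1_(~` G)) \* \1_(~` hull B))%R.

(** The mean [c] is extended over the whole ball [G] in the first term, so that
    the uniform vanishing of [T] on indicators of large balls can be used; the
    other two terms vanish on [hull B], as the BO condition requires. *)
Lemma far_part_decomp : hull B `<=` G ->
  far_part = (fun x => c * \1_G x + (1 * middle_part x + outer_part x))%R.
Proof.
move=> HG; apply/funext => x.
rewrite /far_part /near_part /middle_part /outer_part /= !indicE !in_setC.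
have [xH|xH] := boolP (x \in hull B).
  by rewrite (mem_set (HG _ (set_mem xH)))/=; ring.
by case: (x \in G) => /=; ring.
Qed.

End truncation.

Lemma OSC_middle_part G : balls G ->
  OSC mu B (T (middle_part G)) <= (L * (4 * (K * eta * M)))%:E.
Proof.
move=> bG; have mG := ball_measurable bb bG.
apply: BO_bound_le => // [|A bA BA]; first exact: (Lfun_sub_cst bb).
apply: le_trans (log_growth bb K1 hullK eta2 dbl hr fL bB sharpM bA BA).
have t0 : (0 <= m A / m B)%R by rewrite divr_ge0 ?ltW// (ball_fine_gt0 bb).
rewrite lee_wpmul2l ?lee_fin ?omega_log_ge0//.
have mfc := measurable_sub_cst fL c.
have mA := ball_measurable bb bA.
apply: (le_avg_r hr mA (ball_pos bb bA) (ball_fin bb bA)) => //.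
  exact: measurable_mul_indic.
by move=> x _; exact: abs_mul_indic_le.
Qed.

(** The function [far_part] does not depend on the truncation [G], which can
    therefore be chosen in terms of [e]: the indicator term and the outer term
    contribute at most [e / 2] each, and only the middle term survives. *)
Lemma OSC_far_part : OSC mu B (T far_part) <= (L * (4 * (K * eta * M)))%:E.
Proof.
apply/lee_addgt0Pr => e e0.
have c1 : (0 < `|c| + 1)%R by rewrite ltr_wpDl.
have L1 : (0 < L + 1)%R by rewrite ltr_wpDl.
pose e1 := (e / 2 / (`|c| + 1))%R.
pose e2 := (e / 4 / (L + 1))%R.
have e10 : (0 < e1)%R by rewrite !divr_gt0.
have e20 : (0 < e2)%R by rewrite !divr_gt0.
have bH := hull_ball bb bB; have mB0 := ball_fine_gt0 bb bB.
have e2B0 : (0 < e2 * m B `^ r^-1)%R by rewrite mulr_gt0// powR_gt0.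
have [B' [bB' BB' vanB']] := vanT bB e10.
have [B1 [bB1 B'B1 HB1]] := balls_directed bb bB' bH.
have [G [bG B1G fG]] := norm_outside_ball bb hr fL bB1 e2B0.
have HG : hull B `<=` G by exact: subset_trans B1G.
have mG := ball_measurable bb bG; have mH := ball_measurable bb bH.
have GL : \1_G \in Lr by apply: Lfun_indic => //; exact: ball_fin bb _ bG.
have fGL : (f \* \1_(~` G))%R \in Lr.
  by apply: Lfun_restrict => //; exact: measurableC.
have h1L : middle_part G \in Lr.
  by apply: Lfun_restrict => //; [exact: measurableC|exact: (Lfun_sub_cst bb)].
have h2L : outer_part G \in Lr.
  by apply: Lfun_restrict => //; exact: measurableC.
have h12L : (fun x => 1 * middle_part G x + outer_part G x)%R \in Lr.
  have r1 : 1 <= r%:E by rewrite lee_fin.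
  exact: (Lfun_submod_closed mu r1).2.
have /osc_leP[N1 neg1 osc1] : OSC mu B (T \1_G) <= e1%:E.
  by apply: vanB' => //; exact: subset_trans B1G.
have /osc_leP[N2 neg2 osc2] := OSC_middle_part bG.
have /osc_leP[N3 neg3 osc3] := OSC_outer_part fL bB fG fGL.
have [N4 neg4 lin4] := ae_off (linT c GL h12L).
have [N5 neg5 lin5] := ae_off (linT 1%R h1L h2L).
rewrite (far_part_decomp HG) -EFinD.
have Nneg : mu.-negligible (N1 `|` N2 `|` N3 `|` N4 `|` N5).
  by do 4 apply: negligibleU => //.
apply/osc_leP; exists (N1 `|` N2 `|` N3 `|` N4 `|` N5) => //; set N := _ `|` N5.
have subN N' : N' `<=` N -> B `\` N `<=` B `\` N' by exact: setDS.
have E1 := osc_le_subset (subN N1 _) osc1.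
have E2 := osc_le_subset (subN N2 _) osc2.
have E3 := osc_le_subset (subN N3 _) osc3.
have E5 : osc_le (B `\` N) (T (fun x => 1 * middle_part G x + outer_part G x)%R)
    (`|1| * (L * (4 * (K * eta * M))) + L * (2 * e2))%R.
  apply: osc_le_lin (E2 _) (E3 _) _; rewrite /N.
  - by move=> x; do 3 left; right.
  - by move=> x; do 2 left; right.
  - by move=> x [_ nNx]; apply: lin5 => N5x; apply: nNx; right.
have E4 : osc_le (B `\` N)
   (T (fun x => c * \1_G x + (1 * middle_part G x + outer_part G x))%R)
    (`|c| * e1 + (`|1| * (L * (4 * (K * eta * M))) + L * (2 * e2)))%R.
  apply: osc_le_lin (E1 _) E5 _; rewrite /N.
  - by move=> x; do 4 left.
  - by move=> x [_ nNx]; apply: lin4 => N4x; apply: nNx; left; right.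
move=> x x' Ex Ex'; apply: (le_trans (E4 x x' Ex Ex')).
rewrite lee_fin normr1 mul1r.
have : (`|c| * e1 <= e / 2)%R.
  rewrite /e1 mulrA ler_pdivrMr// mulrC ler_wpM2l ?lerDl//; lra.
have : (L * (2 * e2) <= e / 2)%R.
  rewrite /e2 !mulrA ler_pdivrMr//; have := mulr_ge0 L0 (ltW e0); lra.
lra.
Qed.

End far_part.

(** * Extremal operators of a family *)

Lemma lee_abs_range (R : realType) (x : \bar R) (t : R) :
  (`|x| <= t%:E) = (- t%:E <= x <= t%:E).
Proof.
case: x => [x| |] /=; last 2 first.
- by rewrite andbF.
- by [].
by rewrite !lee_fin ler_norml.
Qed.

Section extremal_operators.
Context d (X : measurableType d) (R : realType).
Variables (I : Type) (Ta : I -> (X -> R) -> (X -> \bar R)).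
Variable T : (X -> R) -> (X -> \bar R).
Hypothesis Text : T = sup_op Ta \/ T = inf_op Ta \/ T = maximal_op Ta.

Lemma extremal_op_empty (g : X -> R) x : (I -> False) -> `|T g x| = +oo.
Proof.
move=> I0.
have im0 (h : I -> \bar R) : [set h i | i in [set: I]] = set0.
  by apply/seteqP; split=> y // [i]; case: (I0 i).
case: Text => [->|[->|->]].
- by rewrite /sup_op im0 ereal_sup0.
- by rewrite /inf_op im0 ereal_inf0.
- by rewrite /maximal_op im0 ereal_sup0.
Qed.

Lemma extremal_op_eq0 (g : X -> R) x (i0 : I) :
  (forall i, Ta i g x = 0) -> T g x = 0.
Proof.
move=> g0.
have im1 (h : I -> \bar R) : (forall i, h i = 0) ->
    [set h i | i in [set: I]] = [set 0].
  move=> h0; apply/seteqP; split=> y; first by move=> [i _ <-]; exact: h0.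
  by move=> ->; exists i0.
case: Text => [->|[->|->]].
- by rewrite /sup_op im1// ereal_sup1.
- by rewrite /inf_op im1// ereal_inf1.
- by rewrite /maximal_op im1 ?ereal_sup1// => i; rewrite g0 abse0.
Qed.

(** For [sup] the upper bound comes from [g] and the lower bound from its
    opposite [g'], for [inf] the other way round; for [sup |.|] the bound at [g]
    alone is enough. *)
Lemma extremal_op_bounds (g g' : X -> R) x (t : R) :
  (forall i, Ta i g' x = - Ta i g x) ->
  `|T g x| <= t%:E -> `|T g' x| <= t%:E ->
  forall i, `|Ta i g x| <= t%:E.
Proof.
move=> gg' gt g't i; rewrite lee_abs_range.
case: Text gt g't => [->|[->|->]].
- rewrite !lee_abs_range => /andP[_ gt] /andP[_ g't]; apply/andP; split.
    rewrite leeNl -gg'; apply: le_trans g't; apply: ereal_sup_ubound.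
    by exists i.
  by apply: le_trans gt; apply: ereal_sup_ubound; exists i.
- rewrite !lee_abs_range => /andP[gt _] /andP[g't _]; apply/andP; split.
    by apply: (le_trans gt); apply: ereal_inf_lbound; exists i.
  rewrite -leeN2 -gg'; apply: (le_trans g't); apply: ereal_inf_lbound.
  by exists i.
- move=> gt _; rewrite -lee_abs_range; apply: le_trans gt.
  apply: le_trans (lee_abs _); apply: ereal_sup_ubound.
  by exists i.
Qed.

Lemma lee_dist_add (a b : \bar R) (s : R) : `|a - b| <= s%:E -> a <= b + s%:E.
Proof.
case: a => [a| |]; case: b => [b| |] //=; rewrite ?leNye ?leey// !lee_fin.
by rewrite ler_norml => /andP[_ h]; lra.
Qed.

Lemma lee_dist_abs_add (a b : \bar R) (s : R) :
  `|a - b| <= s%:E -> `|a| <= `|b| + s%:E.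
Proof.
case: a => [a| |]; case: b => [b| |] //=; rewrite !lee_fin => h.
by have := ler_normD (a - b)%R b; rewrite subrK; lra.
Qed.

Lemma extremal_op_le_add (g : X -> R) x x' (s : R) :
  (forall i, `|Ta i g x - Ta i g x'| <= s%:E) -> T g x <= T g x' + s%:E.
Proof.
move=> gs; case: Text => [->|[->|->]].
- apply/ereal_supP => y [i _ <-]; apply: (le_trans (lee_dist_add (gs i))).
  by rewrite leeD2r//; apply: ereal_sup_ubound; exists i.
- rewrite -leeBlDr//; apply/ereal_infP => y [i _ <-]; rewrite leeBlDr//.
  apply: le_trans (lee_dist_add (gs i)).
  by apply: ereal_inf_lbound; exists i.
- apply/ereal_supP => y [i _ <-]; apply: (le_trans (lee_dist_abs_add (gs i))).
  by rewrite leeD2r//; apply: ereal_sup_ubound; exists i.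
Qed.

Lemma extremal_op_osc (g : X -> R) x x' (s : R) :
  (forall i, `|Ta i g x - Ta i g x'| <= s%:E) ->
  T g x \is a fin_num -> T g x' \is a fin_num ->
  `|T g x - T g x'| <= s%:E.
Proof.
move=> gs; have gs' i : `|Ta i g x' - Ta i g x| <= s%:E.
  have := gs i; case: (Ta i g x) => [a| |]; case: (Ta i g x') => [b| |] //=.
  by rewrite distrC.
have := extremal_op_le_add gs; have := extremal_op_le_add gs'.
case: (T g x) => [a| |] //; case: (T g x') => [b| |] //=; rewrite !lee_fin.
by move=> ? ? _ _; rewrite ler_norml; apply/andP; split; lra.
Qed.

End extremal_operators.

(** * Weak type *)

Section near_part_estimates.
Context d (X : measurableType d) (R : realType).
Variables (mu : {measure set X -> \bar R}).
Variables (balls : set (set X)) (hull : set X -> set X).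
Hypothesis bb : ball_basis mu balls hull.
Variables (r : R).
Hypothesis hr : (1 <= r)%R.
Notation Lr := (Lfun mu r%:E).
Notation norm f := ('N[mu]_(r%:E)[EFin \o f]).
Variables (I : Type) (Ta : I -> (X -> R) -> (X -> \bar R))
  (T : (X -> R) -> (X -> \bar R)).
Hypothesis linTa : forall i, linear_op mu r (Ta i).
Hypothesis L0Ta : forall i, Lr_to_L0 mu r (Ta i).
Hypothesis cohTa : coherent mu r balls Ta.
Hypothesis Text : T = sup_op Ta \/ T = inf_op Ta \/ T = maximal_op Ta.
Implicit Types (f g : X -> R) (A B N : set X).

Lemma setD_negligible_neq0 A N : measurable A -> 0 < mu A ->
  mu.-negligible N -> (A `\` N) !=set0.
Proof.
move=> mA A0 negN; apply: contrapT => AN.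
have : mu.-negligible A.
  apply: negligibleS negN => x Ax; apply: contrapT => nNx.
  by apply: AN; exists x.
by move=> /(measure_negligible mA) muA0; rewrite muA0 ltxx in A0.
Qed.

Lemma Lfun0 : (cst 0%R : X -> R) \in Lr.
Proof.
have r1 : 1 <= r%:E by rewrite lee_fin.
exact: (Lfun_submod_closed mu r1).1.
Qed.

(** Linearity gives [T 0 = T 0 + T 0], and [T 0] is finite almost everywhere. *)
Lemma linear_op_zero_fun i : {ae mu, forall x, Ta i (cst 0%R) x = 0}.
Proof.
have c0 := Lfun0.
have [/(_ _ c0)[_ fin0] _] := L0Ta i.
apply: filterS2 fin0 (linTa i 1%R c0 c0) => x.
rewrite (_ : (fun y => _) = cst 0%R); last first.
  by apply/funext => y /=; rewrite mulr0 addr0.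
case: (Ta i _ x) => [a| |]//= _ [] /esym/eqP.
by rewrite mul1r -subr_eq0 addrK => /eqP ->.
Qed.

(** Each [Ta i g] vanishes outside a null set that may depend on [i].  A common
    null set is obtained from the coherence of oscillations: outside it, every
    [Ta i g] is constant on [B], and this constant is [0], a value taken
    somewhere because [B] has positive measure. *)
Lemma norm0_op_eq0 g B : g \in Lr -> norm g = 0 -> balls B ->
  exists2 N, mu.-negligible N & forall x i, B x -> ~ N x -> Ta i g x = 0.
Proof.
move=> gL ng0 bB; have r0 := exponent_gt0 hr.
have [mg _] := (Lfun_normP mu r g).1 gL.
have mEg : measurable_fun [set: X] (EFin \o g) by exact/measurable_EFinP.
have g0 : {ae mu, forall x, g x = cst 0%R x}.
  have := Lnorm_eq0_eq0 (p := r%:E) mEg r0 ng0.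
  by apply: filterS => x /(_ Logic.I) [].
have [N0 neg0 oscN0] := cohTa.2 g B gL bB.
exists N0 => // x i Bx nN0x.
have [N neg Tg0] : exists2 N, mu.-negligible N &
    forall y, ~ N y -> Ta i g y = 0.
  apply: ae_off; have Tg := (L0Ta i).2 g (cst 0%R) gL Lfun0 g0.
  by apply: filterS2 Tg (linear_op_zero_fun i) => y -> ->.
have osc0 : OSC mu B (Ta i g) <= 0%:E.
  apply/osc_leP; exists N => // y y' [_ /Tg0 ->] [_ /Tg0 ->].
  by rewrite sube0 abse0.
have [y [By nNy]] := setD_negligible_neq0 (ball_measurable bb bB)
  (ball_pos bb bB) (negligibleU neg0 neg).
have nN0y : ~ N0 y by move=> h; apply: nNy; left.
have : `|Ta i g x - Ta i g y| <= 0%:E.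
  apply: le_trans osc0; apply: le_trans (oscN0 i); apply: ereal_sup_ubound.
  by exists x, y.
rewrite (Tg0 y) ?sube0 => [|h]; last by apply: nNy; right.
by move=> h; apply/eqP; rewrite -abse_eq0 eq_le h abse_ge0.
Qed.

Lemma weak_norm_ge0 F : 0 <= weak_norm mu r F.
Proof.
apply: le_ereal_sup_tmp.
exists (1%:E * outer mu [set x | 1%:E < `|F x|] `^ r^-1).
  by exists 1%R => //=; exact: ltr01.
by rewrite mul1e poweR_ge0.
Qed.

Lemma outer_ge0 E : 0 <= outer mu E.
Proof. by apply/ereal_infP => y [F [_ _] <-]; exact: measure_ge0. Qed.

Lemma norm_ball_neq0 B : balls B -> norm \1_B != 0.
Proof.
move=> bB; have mB := ball_measurable bb bB.
rewrite (Lnorm_indic mu (exponent_gt0 hr) mB) gt_eqF// poweR_gt0//.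
exact: ball_pos bb _ bB.
Qed.

Lemma ball_indic_Lfun B : balls B -> \1_B \in Lr.
Proof.
by move=> bB; apply: Lfun_indic => //;
  [exact: ball_measurable bb _ bB|exact: ball_fin bb _ bB].
Qed.

Lemma opnorm_ge0 B : balls B -> 0 <= opnorm mu r T.
Proof.
move=> bB; apply: le_ereal_sup_tmp.
exists (weak_norm mu r (T \1_B) / norm \1_B).
  by exists \1_B => //; split; [exact: ball_indic_Lfun|exact: norm_ball_neq0].
by rewrite mule_ge0 ?weak_norm_ge0// inve_ge0 Lnorm_ge0.
Qed.

Section weak_type.
Variable P : R.
Hypothesis TP : opnorm mu r T <= P%:E.

Lemma weak_type g (t s : R) : g \in Lr -> norm g != 0 ->
  (0 < t)%R -> (0 < s)%R -> (P * fine (norm g) < t * s `^ r^-1)%R ->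
  exists F, [/\ measurable F, mu F < s%:E &
    forall x, ~ F x -> `|T g x| <= t%:E].
Proof.
move=> gL ng0 t0 s0 Pts; have r0 := exponent_gt0 hr.
have [mg ngoo] := (Lfun_normP mu r g).1 gL.
have nfin : norm g \is a fin_num by rewrite ge0_fin_numE// Lnorm_ge0.
have n0 : (0 < fine (norm g))%R.
  by rewrite fine_gt0// ngoo andbT lt0e ng0 Lnorm_ge0.
have Wg : weak_norm mu r (T g) <= (P * fine (norm g))%:E.
  have : weak_norm mu r (T g) / norm g <= P%:E.
    by apply: le_trans TP; apply: ereal_sup_ubound; exists g.
  by rewrite -(fineK nfin) inver gt_eqF// lee_pdivrMr// EFinM.
have : t%:E * outer mu [set x | t%:E < `|T g x|] `^ r^-1 < (t * s `^ r^-1)%:E.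
  apply: (@le_lt_trans _ _ (P * fine (norm g))%:E); last by rewrite lte_fin.
  by apply: le_trans Wg; apply: ereal_sup_ubound; exists t.
rewrite EFinM lte_pmul2l// => os.
have : outer mu [set x | t%:E < `|T g x|] < s%:E.
  rewrite ltNge; apply/negP => so.
  have : s%:E `^ r^-1 <= outer mu [set x | t%:E < `|T g x|] `^ r^-1.
    by apply: gt0_ler_poweR => //;
      rewrite ?invr_ge0 ?in_itv/= ?leey ?andbT ?lee_fin ?outer_ge0//;
      exact: ltW.
  by rewrite poweR_EFin leNgt os.
move=> /ereal_inf_lt[_ [F [mF TF] <-] Fs]; exists F; split => // x nFx.
by rewrite leNgt; apply/negP => h; apply/nFx/TF.
Qed.

Lemma opnorm_bound_ge0 B : balls B -> (0 <= P)%R.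
Proof. by move=> bB; rewrite -lee_fin (le_trans (opnorm_ge0 bB)). Qed.

(** Over an empty family, [T] is infinite everywhere, which contradicts the weak
    type bound for the indicator of a ball. *)
Lemma family_inhabited B : balls B -> inhabited I.
Proof.
move=> bB; apply: contrapT => I0.
have r0 := exponent_gt0 hr; have mB0 := ball_fine_gt0 bb bB.
pose q := (fine (mu B) `^ r^-1)%R.
have q0 : (0 < q)%R by rewrite powR_gt0.
have P0 := opnorm_bound_ge0 bB.
pose Q := (P * fine (norm \1_B))%R.
have Q0 : (0 <= Q)%R by rewrite mulr_ge0// fine_ge0// Lnorm_ge0.
have [|||F [mF FB TF]] := @weak_type \1_B ((Q + 1) / q)%R (fine (mu B))
  (ball_indic_Lfun bB) (norm_ball_neq0 bB).
- by rewrite divr_gt0// ltr_wpDl.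
- by [].
- by rewrite divfK ?gt_eqF// ltrDl.
have [x [Bx nFx]] : (B `\` F) !=set0.
  apply: contrapT => BF; suff : mu B <= mu F.
    by rewrite leNgt (ball_fineE bb bB) FB.
  apply: le_measure; rewrite ?inE//; first exact: ball_measurable bb _ bB.
  by move=> x Bx; apply: contrapT => nFx; apply: BF; exists x.
have := TF x nFx; rewrite (extremal_op_empty Text)//.
by move=> i; apply: I0.
Qed.

(** Functions of norm zero do not contribute to [opnorm], so the weak-type bound
    says nothing about them; the operators of the family kill them on [B]
    outside one null set. *)
Lemma weak_type_on_ball g B (t s : R) : g \in Lr -> balls B ->
  (0 < t)%R -> (0 < s)%R -> (P * fine (norm g) < t * s `^ r^-1)%R ->
  exists F N, [/\ measurable F, mu F < s%:E, mu.-negligible N &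
    forall x, B x -> ~ F x -> ~ N x -> `|T g x| <= t%:E].
Proof.
move=> gL bB t0 s0 Pts; have [ng0|ng0] := eqVneq (norm g) 0.
  have [N negN Ng] := norm0_op_eq0 gL ng0 bB.
  exists set0, N; split=> //; first by rewrite measure0 lte_fin.
  move=> x Bx _ nNx; have [i0] := family_inhabited bB.
  rewrite (extremal_op_eq0 Text i0) ?abse0 ?lee_fin ?ltW// => i.
  exact: Ng.
have [F [mF Fs TF]] := weak_type gL ng0 t0 s0 Pts.
exists F, set0; split => //; first exact: negligible_set0.
by move=> x _ nFx _; exact: TF.
Qed.

End weak_type.

End near_part_estimates.

(** * Local oscillation of an extremal operator *)

Section local_oscillation.
Context d (X : measurableType d) (R : realType).
Variables (mu : {measure set X -> \bar R}).
Variables (balls : set (set X)) (hull : set X -> set X).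
Hypothesis bb : ball_basis mu balls hull.
Local Notation m A := (fine (mu A)).
Variables K : R.
Hypothesis K1 : (1 <= K)%R.
Hypothesis hullK : forall B, balls B -> mu (hull B) <= K%:E * mu B.
Variables (r : R).
Hypothesis hr : (1 <= r)%R.
Notation Lr := (Lfun mu r%:E).
Notation norm f := ('N[mu]_(r%:E)[EFin \o f]).
Variables (f : X -> R) (B : set X).
Hypothesis fL : f \in Lr.
Hypothesis bB : balls B.
Notation near := (near_part mu hull f B).
Notation far := (far_part mu hull f B).

Lemma near_part_Lfun : near \in Lr.
Proof. exact: (Lfun_sub_cst bb hr (avg mu B f) fL (hull_ball bb bB)). Qed.

Lemma far_part_Lfun : far \in Lr.
Proof.
have r1 : 1 <= r%:E by rewrite lee_fin.
suff <- : ((-1) *: near + f = far)%R.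
  exact: (Lfun_submod_closed mu r1).2 (- 1)%R _ _ near_part_Lfun fL.
apply/funext => x; transitivity (-1 * near x + f x)%R; first by [].
by rewrite /far_part /= mulN1r addrC.
Qed.

Section sharp_bound.
Variable M : R.
Hypothesis sharpM : forall A, balls A -> B `<=` A -> avg_sharp mu r A f <= M%:E.

(** The triangle inequality through the mean over [hull B], which differs from
    that over [B] by at most [K * M]. *)
Lemma near_part_norm_le : norm near <= (2 * (K * M) * (K * m B) `^ r^-1)%:E.
Proof.
have bH := hull_ball bb bB; have mH := ball_measurable bb bH.
have H0 := ball_pos bb bH; have Hoo := ball_fin bb bH.
have BH := ball_sub_hull bb bB; have mHK := hull_fine_le bb hullK bB.
have M0 := sharp_bound_ge0 bB sharpM; have r0 := exponent_gt0 hr.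
have mfc c := measurable_sub_cst fL c.
rewrite /near_part (Lnorm_restrictE hr H0 Hoo (mfc _)) EFinM.
apply: lee_pmul; rewrite ?avg_r_ge0 ?lee_fin ?powR_ge0//; last first.
  have mH0 := ball_fine_gt0 bb bH; have mB0 := ball_fine_gt0 bb bB.
  have K1' := K1.
  by apply: ge0_ler_powR; rewrite ?nnegrE ?invr_ge0 ?mulr_ge0//; lra.
have sH := sharpM bH BH.
have h := avg_nested bb hr fL bB bH BH K1 mHK sH.
rewrite (_ : (fun x => f x - avg mu B f) = (fun x => f x - avg mu (hull B) f) \+
    cst (avg mu (hull B) f - avg mu B f))%R; last first.
  by apply/funext => x /=; rewrite addrA subrK.
apply: le_trans.
  by apply: (avg_r_triangle hr mH H0 Hoo) => //; exact: mfc.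
rewrite (avg_r_cst hr mH H0 Hoo).
apply: (@le_trans _ _ (M%:E + (K * M)%:E)).
  by rewrite leeD ?lee_fin//; rewrite distrC.
rewrite -EFinD lee_fin.
have : (M <= K * M)%R by rewrite ler_peMl.
lra.
Qed.

Variables (I : Type) (Ta : I -> (X -> R) -> (X -> \bar R))
  (T : (X -> R) -> (X -> \bar R)).
Hypothesis linTa : forall i, linear_op mu r (Ta i).
Hypothesis L0Ta : forall i, Lr_to_L0 mu r (Ta i).
Hypothesis cohTa : coherent mu r balls Ta.
Hypothesis Text : T = sup_op Ta \/ T = inf_op Ta \/ T = maximal_op Ta.
Variables (P S beta : R).
Hypothesis TP : opnorm mu r T <= P%:E.
Hypothesis farS : forall i, OSC mu B (Ta i far) <= S%:E.
Hypothesis beta01 : (0 < beta < 1)%R.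

(* Three exceptional sets of measure [s] leave more than [beta * mu B]. *)
Let s := ((1 - beta) / 4 * m B)%R.

Let s_gt0 : (0 < s)%R.
Proof.
case/andP: beta01 => _ b1; apply: mulr_gt0; last exact: ball_fine_gt0 bb _ bB.
by rewrite divr_gt0// subr_gt0.
Qed.

(* Written in the form [a f + g] in which linearity is stated. *)
Let neg_near : X -> R := (fun x => -1 * near x + cst 0 x)%R.

Let neg_nearE : neg_near = (\- near)%R.
Proof. by apply/funext => x; rewrite /neg_near /= mulN1r addr0. Qed.

Let weak_level := (8 * K ^+ 2 * (1 - beta) `^ (- r^-1) * P * M)%R.

(** At the level [weak_level + e], the weak-type inequality for [near] yields an
    exceptional set of measure less than [s]; the strict inequality is what [e]
    is for.  The factor [(1 - beta)^(-1/r)] arises from expressing [mu (hull B)]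
    in terms of [s]. *)
Lemma near_part_weak_level (e : R) : (0 < e)%R ->
  (P * fine (norm near) < (weak_level + e) * s `^ r^-1)%R.
Proof.
move=> e0; have /andP[b0 b1] := beta01; have r0 := exponent_gt0 hr.
have P0 := opnorm_bound_ge0 bb hr TP bB; have K1' := K1.
have M0 := sharp_bound_ge0 bB sharpM.
have K0 : (0 <= K)%R by lra.
have u0 : (0 < 1 - beta)%R by lra.
have KB : (K * m B = 4 * K * ((1 - beta)^-1 * s))%R.
  rewrite /s; field; lra.
have pK : ((4 * K) `^ r^-1 <= 4 * K)%R.
  rewrite -{2}(powRr1 (_ : 0 <= 4 * K)%R) ?ler_powR ?invf_le1//; lra.
have pE : ((1 - beta)^-1 `^ r^-1 = (1 - beta) `^ (- r^-1))%R.
  by rewrite -(powR_inv1 (ltW u0)) -powRrM mulN1r.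
have nle : (fine (norm near) <=
    2 * (K * M) * (4 * K * ((1 - beta) `^ (- r^-1) * s `^ r^-1)))%R.
  rewrite -lee_fin fineK ?ge0_fin_numE ?Lnorm_ge0//; last first.
    by have [] := (Lfun_normP mu r _).1 near_part_Lfun.
  apply: (le_trans near_part_norm_le).
  have s0 := ltW s_gt0.
  have ui0 : (0 <= (1 - beta)^-1)%R by rewrite invr_ge0; lra.
  rewrite lee_fin ler_wpM2l ?mulr_ge0// KB.
  rewrite (powRM _ _ (mulr_ge0 ui0 s0)) ?mulr_ge0//.
  by rewrite (powRM _ ui0 s0) pE ler_wpM2r// mulr_ge0 ?powR_ge0.
have es : (0 < e * s `^ r^-1)%R by rewrite mulr_gt0 ?powR_gt0.
rewrite mulrDl; apply: (@le_lt_trans _ _ (weak_level * s `^ r^-1)%R); last lra.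
apply: (le_trans (ler_wpM2l P0 nle)).
rewrite /weak_level le_eqVlt; apply/orP; left; apply/eqP; ring.
Qed.

(** Remove from [B] the exceptional sets of [near], [- near] and [f].  The first
    two bound all the [Ta i near] at once; the third makes [T f] finite.  All
    null sets are independent of [i] by coherence. *)
Lemma OSC_beta_le (e : R) : (0 < e)%R ->
  OSC_beta mu B beta (T f) <= (S + 2 * (weak_level + e))%:E.
Proof.
move=> e0; have /andP[b0 b1] := beta01; have r0 := exponent_gt0 hr.
have P0 := opnorm_bound_ge0 bb hr TP bB; have K1' := K1.
have M0 := sharp_bound_ge0 bB sharpM.
set t := (weak_level + e)%R.
have t0 : (0 < t)%R.
  by rewrite ltr_wpDl// /weak_level !mulr_ge0 ?powR_ge0 ?exprn_ge0//; lra.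
have q0 : (0 < s `^ r^-1)%R by rewrite powR_gt0.
have nearL := near_part_Lfun; have farL := far_part_Lfun.
have neg_nearL : neg_near \in Lr.
  have r1 : 1 <= r%:E by rewrite lee_fin.
  exact: (Lfun_submod_closed mu r1).2 (- 1)%R _ _ nearL (Lfun0 mu hr).
have norm_neg : norm neg_near = norm near.
  by rewrite neg_nearE; exact: (oppe_Lnorm mu (EFin \o near)).
have near_t := near_part_weak_level e0.
have neg_near_t : (P * fine (norm neg_near) < t * s `^ r^-1)%R.
  by rewrite norm_neg.
(* Only the finiteness of [T f] matters here, so the level may be huge. *)
pose t3 := ((P * fine (norm f) + 1) / s `^ r^-1)%R.
have Pf0 : (0 <= P * fine (norm f))%R.
  by rewrite mulr_ge0// fine_ge0// Lnorm_ge0.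
have t30 : (0 < t3)%R by rewrite divr_gt0// ltr_wpDl.
have f_t3 : (P * fine (norm f) < t3 * s `^ r^-1)%R.
  by rewrite divfK ?gt_eqF// ltrDl.
have weak g u := weak_type_on_ball bb hr linTa L0Ta cohTa Text TP
  (g := g) (B := B) (t := u) (s := s).
have [F1 [N1 [mF1 F1s neg1 TF1]]] := weak near t nearL bB t0 s_gt0 near_t.
have [F2 [N2 [mF2 F2s neg2 TF2]]] :=
  weak neg_near t neg_nearL bB t0 s_gt0 neg_near_t.
have [F3 [N3 [mF3 F3s neg3 TF3]]] := weak f t3 fL bB t30 s_gt0 f_t3.
have [N4 neg4 osc4] := cohTa.2 far B farL bB.
have [N5 neg5 lin5] := ae_off (cohTa.1 1%R near far nearL farL).
have [N6 neg6 lin6] :=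
  ae_off (cohTa.1 (- 1)%R near (cst 0%R) nearL (Lfun0 mu hr)).
have norm0 : norm (cst 0%R : X -> R) = 0.
  by rewrite (_ : EFin \o _ = cst 0)// Lnorm0// gt_eqF.
have [N7 neg7 zero7] :=
  norm0_op_eq0 bb hr linTa L0Ta cohTa (Lfun0 mu hr) norm0 bB.
pose E := B `\` (F1 `|` F2 `|` F3).
pose N := N1 `|` N2 `|` N3 `|` N4 `|` N5 `|` N6 `|` N7.
have negN : mu.-negligible N by do 6 apply: negligibleU => //.
have mF : measurable (F1 `|` F2 `|` F3) by do 2 apply: measurableU => //.
have mB := ball_measurable bb bB.
have mE : measurable E by exact: measurableD.
have muE_gt : beta%:E * mu B < mu E.
  have BE : B `<=` E `|` (F1 `|` F2 `|` F3).
    move=> x Bx.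
    by have [Fx|nFx] := pselect ((F1 `|` F2 `|` F3) x); [right|left].
  have muF : mu (F1 `|` F2 `|` F3) <= (3 * s)%:E.
    apply: le_trans; first by apply: measureU2 => //; exact: measurableU.
    rewrite (_ : (3 * s = s + s + s)%R); last by ring.
    rewrite !EFinD leeD ?(ltW F3s)//.
    by apply: le_trans; [exact: measureU2|rewrite leeD// ltW].
  have muB : mu B <= mu E + (3 * s)%:E.
    apply: (@le_trans _ _ (mu (E `|` (F1 `|` F2 `|` F3)))).
      by apply: le_measure; rewrite ?inE//; exact: measurableU.
    by apply: le_trans; [exact: measureU2|rewrite leeD2l].
  rewrite (ball_fineE bb bB) -EFinM.
  have : (m B - 3 * s)%:E <= mu E.
    by rewrite EFinB leeBlDr// -(ball_fineE bb bB).
  apply: lt_le_trans; rewrite lte_fin /s.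
  have mB0 := ball_fine_gt0 bb bB.
  have : (0 < (1 - beta) * m B)%R by rewrite mulr_gt0// subr_gt0.
  lra.
apply: (@le_trans _ _ (OSC mu E (T f))).
  apply: ereal_inf_lbound; exists E => //; split => //.
  by move=> x [].
apply/osc_leP; exists N => // x x' [Ex nNx] [Ex' nNx'].
have good y : E y -> ~ N y -> forall i, `|Ta i near y| <= t%:E.
  move=> [By nFy] nNy; apply: (extremal_op_bounds Text (g' := neg_near)).
  - move=> i; rewrite lin6 => [|h]; last by apply: nNy; left; right.
    by rewrite zero7// ?adde0 ?mulN1e// => h; apply: nNy; right.
  - apply: TF1 => // h; first by apply: nFy; do 2 left.
    by apply: nNy; do 6 left.
  - apply: TF2 => // h; first by apply: nFy; left; right.
    by apply: nNy; do 5 left; right.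
have fE : f = (fun y => 1 * near y + far y)%R.
  by apply/funext => y; rewrite /far_part /= mul1r addrC subrK.
have Tfin y : E y -> ~ N y -> T f y \is a fin_num.
  move=> [By nFy] nNy; have : `|T f y| <= t3%:E.
    apply: TF3 => // h; first by apply: nFy; right.
    by apply: nNy; do 4 left; right.
  by case: (T f y).
apply: (extremal_op_osc Text); [|exact: Tfin..] => i.
have nearO : osc_le (E `\` N) (Ta i near) (2 * t)%R.
  move=> y y' [Ey nNy] [Ey' nNy'].
  apply: (le_trans (lee_abs_sub _ _)).
  rewrite (_ : (2 * t = t + t)%R); last by ring.
  by rewrite EFinD leeD// good.
have farO : osc_le (E `\` N) (Ta i far) S.
  move=> y y' [[By _] nNy] [[By' _] nNy'].
  apply: le_trans (farS i); apply: le_trans (osc4 i); apply: ereal_sup_ubound.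
  exists y, y'; split=> //; split=> // h.
    by apply: nNy; do 3 left; right.
  by apply: nNy'; do 3 left; right.
have lin y : (E `\` N) y -> Ta i f y = 1%:E * Ta i near y + Ta i far y.
  by move=> [_ nNy]; rewrite {1}fE lin5// => h; apply: nNy; do 2 left; right.
have := osc_le_lin nearO farO lin (conj Ex nNx) (conj Ex' nNx').
by rewrite normr1 mul1r [(2 * t + S)%R]addrC.
Qed.

End sharp_bound.

End local_oscillation.

(** * Finiteness of the sharp mean and conclusion *)

Section sharp_star.
Context d (X : measurableType d) (R : realType).
Variables (mu : {measure set X -> \bar R}).
Variables (balls : set (set X)) (hull : set X -> set X).
Hypothesis bb : ball_basis mu balls hull.
Local Notation m A := (fine (mu A)).
Variables (r : R).
Hypothesis hr : (1 <= r)%R.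
Notation Lr := (Lfun mu r%:E).
Notation norm f := ('N[mu]_(r%:E)[EFin \o f]).

Lemma avg_sharp_le f A : f \in Lr -> balls A ->
  avg_sharp mu r A f <= 2%:E * avg_r mu r A f.
Proof.
move=> fL bA; have mA := ball_measurable bb bA.
have A0 := ball_pos bb bA; have Aoo := ball_fin bb bA.
have [mf _] := (Lfun_normP mu r f).1 fL.
rewrite /avg_sharp.
rewrite (_ : (fun x => f x - avg mu A f) = f \+ cst (- avg mu A f))%R//.
apply: le_trans; first by apply: (avg_r_triangle hr mA A0 Aoo).
rewrite (avg_r_cst hr mA A0 Aoo) normrN -[2%R]/(1 + 1)%R EFinD.
rewrite ge0_muleDl// mul1e leeD2l//.
have := avg_dist hr mA A0 Aoo 0%R mf (Lfun_restrict hr mA fL).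
by rewrite subr0; under [X in avg_r _ _ _ X]eq_fun do rewrite subr0.
Qed.

(** Finiteness matters: a product [0 * +oo] on the right-hand side of an
    oscillation estimate would be [0]. *)
Lemma avg_sharp_star_fin f B : f \in Lr -> balls B ->
  avg_sharp_star mu r balls B f \is a fin_num.
Proof.
move=> fL bB; have mB0 := ball_fine_gt0 bb bB; have r0 := exponent_gt0 hr.
have [_ ngoo] := (Lfun_normP mu r f).1 fL.
rewrite ge0_fin_numE; last first.
  apply: (@le_trans _ _ (avg_sharp mu r B f)); first exact: poweR_ge0.
  by apply: ereal_sup_ubound; exists B => //; split.
apply: (@le_lt_trans _ _ (2%:E * (norm f * (m B `^ (- r^-1))%:E))).
  apply/ereal_supP => y [A [bA BA] <-].
  apply: (le_trans (avg_sharp_le fL bA)); rewrite lee_wpmul2l//.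
  apply: (le_trans (avg_r_le_norm hr (ball_measurable bb bA) (ball_pos bb bA)
    (ball_fin bb bA) fL)).
  rewrite lee_wpmul2l ?Lnorm_ge0// lee_fin !powRN.
  have mA0 := ball_fine_gt0 bb bA; have := ball_fine_subset bb bB bA BA => BAm.
  rewrite lef_pV2 ?posrE ?powR_gt0//.
  by apply: ge0_ler_powR; rewrite ?nnegrE ?invr_ge0//; exact: ltW.
by rewrite ltey_eq !fin_numM// ge0_fin_numE// Lnorm_ge0.
Qed.

End sharp_star.

Theorem theorem1p1 (d : measure_display) (X : measurableType d) (R : realType)
    (mu : {measure set X -> \bar R})
    (balls : set (set X)) (hull : set X -> set X) (r : R)
    (hballs : ball_basis mu balls hull)
    (hdoubling : doubling mu balls hull)
    (hr : (1 <= r)%R) :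
  exists C : R, (0 < C)%R /\
    forall (I : Type) (Ta : I -> (X -> R) -> (X -> \bar R))
           (T : (X -> R) -> (X -> \bar R)),
      (forall i, linear_op mu r (Ta i)) ->
      (forall i, BO mu r balls hull (@omega_log R) (Ta i)) ->
      coherent mu r balls Ta ->
      uniformly_vanishing mu balls Ta ->
      T = sup_op Ta \/ T = inf_op Ta \/ T = maximal_op Ta ->
      opnorm mu r T < +oo ->
      ereal_sup [set BO_const mu r balls hull (@omega_log R) (Ta i)
                | i in [set: I]] < +oo ->
      forall (f : X -> R) (B : set X) (beta : R),
        f \in Lfun mu r%:E -> balls B -> (0 < beta < 1)%R ->
        OSC_beta mu B beta (T f) <=
          C%:E * (((1 - beta) `^ (- r^-1))%:E * opnorm mu r T +
                  ereal_sup [set BO_const mu r balls hull (@omega_log R) (Ta i)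
                            | i in [set: I]])
               * avg_sharp_star mu r balls B f.
Proof.
have [K0 [K00 hullK0]] := hull_meas hballs.
have [eta [eta2 dbl]] := hdoubling.
pose K := Num.max 1%R K0.
have K1 : (1 <= K)%R by rewrite le_max lexx.
have hullK B : balls B -> mu (hull B) <= K%:E * mu B.
  move=> bB; apply: (le_trans (hullK0 B bB)).
  by rewrite lee_wpmul2r// lee_fin le_max lexx orbT.
have K2 : (0 < K ^+ 2)%R by rewrite exprn_gt0//; lra.
have Ke : (0 < K * eta)%R by rewrite mulr_gt0//; lra.
(* [16 K^2] is twice the factor [8 K^2] of the weak level, and [4 K eta] is the
   constant of the far part. *)
exists (16 * K ^+ 2 + 4 * (K * eta))%R; split; first lra.
move=> I Ta T linT BOT cohT vanT Text Tfin Lfin f B beta fL bB beta01.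
set PT := opnorm mu r T in Tfin *; set Lam := ereal_sup _ in Lfin *.
have L0T i : Lr_to_L0 mu r (Ta i) by case: (BOT i).
have PT0 : 0 <= PT by exact: (opnorm_ge0 hballs hr _ bB).
have PTE : PT = (fine PT)%:E by rewrite fineK// ge0_fin_numE.
have TP : opnorm mu r T <= (fine PT)%:E by rewrite -PTE.
have [i0] := family_inhabited hballs hr Text TP bB.
have Lam0 : 0 <= Lam.
  apply: le_ereal_sup_tmp.
  exists (BO_const mu r balls hull (@omega_log R) (Ta i0)).
    by exists i0.
  by apply/ereal_infP => y [L [L0 _] <-]; rewrite lee_fin.
have LamE : Lam = (fine Lam)%:E by rewrite fineK// ge0_fin_numE.
have starE : avg_sharp_star mu r balls B f =
    (fine (avg_sharp_star mu r balls B f))%:E.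
  by rewrite fineK// (avg_sharp_star_fin hballs hr).
set M := fine _ in starE.
have sharpM A : balls A -> B `<=` A -> avg_sharp mu r A f <= M%:E.
  by move=> bA BA; rewrite -starE; apply: ereal_sup_ubound; exists A.
have M0 := sharp_bound_ge0 bB sharpM.
rewrite PTE LamE starE; move: (fine PT) (fine Lam) PT0 Lam0 PTE LamE TP => P Q.
move=> + + PTE LamE TP; rewrite PTE LamE !lee_fin => P0 Q0.
rewrite -?EFinM -?EFinD -?EFinM; apply/lee_addgt0Pr => e e0.
pose D := (4 * (K * eta * M))%R.
have D0 : (0 <= D)%R by rewrite /D !mulr_ge0//; lra.
have D1 : (0 < D + 1)%R by lra.
(* Slightly above the supremum of the BO constants, so that it is a BO bound up
   to [e / 2] for every operator without the infimum being attained. *)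
pose L := (Q + e / 2 / (D + 1))%R.
have QL : (Q < L)%R by rewrite ltrDl !divr_gt0.
have farL i : OSC mu B (Ta i (far_part mu hull f B)) <= (L * D)%:E.
  have : BO_const mu r balls hull (@omega_log R) (Ta i) < L%:E.
    apply: (@le_lt_trans _ _ Lam); last by rewrite LamE lte_fin.
    by apply: ereal_sup_ubound; exists i.
  move=> /ereal_inf_lt[_ [L' [L'0 bnd] <-]]; rewrite lte_fin => L'L.
  have vi B1 e1 : balls B1 -> (0 < e1)%R ->
      exists B', [/\ balls B', B1 `<=` B' &
        forall B'', balls B'' -> B' `<=` B'' ->
          OSC mu B1 (Ta i \1_B'') <= e1%:E].
    move=> bB1 e10; have [B' [? ? H]] := vanT B1 e1 bB1 e10.
    by exists B'; split=> // B'' ? ?; exact: H.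
  apply: (le_trans (OSC_far_part hballs K1 hullK eta2 dbl hr (linT i) L'0 bnd vi
    fL bB sharpM)).
  by rewrite lee_fin ler_wpM2r// ltW.
have e4 : (0 < e / 4)%R by rewrite divr_gt0.
apply: (le_trans (OSC_beta_le hballs K1 hullK hr fL bB sharpM linT L0T cohT Text
  TP farL beta01 e4)).
rewrite -EFinD lee_fin.
have LD : (L * D <= Q * D + e / 2)%R.
  rewrite /L mulrDl lerD2l mulrAC ler_pdivrMr// ler_wpM2l//; lra.
set p := ((1 - beta) `^ (- r^-1))%R.
have p0 : (0 <= p)%R by exact: powR_ge0.
have c1 : (0 <= K ^+ 2 * Q * M)%R by exact: mulr_ge0 (mulr_ge0 (ltW K2) Q0) M0.
have c2 : (0 <= K * eta * (p * P) * M)%R.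
  exact: mulr_ge0 (mulr_ge0 (ltW Ke) (mulr_ge0 p0 P0)) M0.
rewrite /D in LD *; lra.
Qed.
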